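(* Let $G$ be a graph and let $f$ be a positive integer-valued function on $V(G)$ satisfying $3m+2m_0+6k<f(v)+k\le b$ for every vertex $v$, and $m+m_0<k$, where $k$, $b$, $m$, and $m_0$ are four nonnegative integers. If $G$ is $4b^2$-tough and $|V(G)|\ge 4b^2$, then $G$ has an $m$-tree-connected factor $H$ such that its complement is $m_0$-tree-connected and for each vertex $v$, $$d_H(v)\in\{f(v),f(v)+k\},$$ provided that $(k-1)\sum_{v\in V(G)}f(v)$ is even.
   Context: Graphs are finite, have no loops, and may have multiple edges. A factor of $G$ is a spanning subgraph of $G$. The complement of a factor $H$ of $G$ is the spanning subgraph of $G$ with edge set $E(G)\setminus E(H)$. $d_H(v)$ is the number of edges of $H$ incident to $v$. A graph is $m$-tree-connected if it has $m$ edge-disjoint spanning trees (for $m=0$ this condition is vacuous). For a positive real $t$, $G$ is $t$-tough if $\omega(G\setminus S)\le\max\{1,\frac1t|S|\}$ for all $S\subseteq V(G)$, where $\omega$ denotes the number of components and $G\setminus S$ is obtained by deleting the vertices of $S$. *)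

(* Defs.v *)
From mathcomp Require Import all_boot all_order all_algebra.
From mathcomp Require Import reals.
Set Implicit Arguments.
Unset Strict Implicit.
Unset Printing Implicit Defensive.
Import Order.TTheory GRing.Theory Num.Theory.
Local Open Scope ring_scope.

(* Parallel edges are distinct edges with the same set of ends; the
   cardinality condition excludes loops. *)
Record multigraph := Multigraph {
  vertex :> finType;
  edge : finType;
  ends : edge -> {set vertex};
  ends_card : forall e, #|ends e| = 2%N }.

(* A factor is a spanning subgraph, hence it is given by its set of edges;
   the complement of the factor H is the factor ~: H. *)
Definition factor (G : multigraph) := {set edge G}.

Definition degree (G : multigraph) (H : factor G) (v : G) : nat :=
  #|[set e in H | v \in ends e]|.

(* Adjacency in H after deletion of the vertices of S. *)
Definition adj (G : multigraph) (H : factor G) (S : {set G}) : rel G :=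
  fun x y =>
    [&& x \notin S, y \notin S & [exists e in H, ends e == [set x; y]]].

(* [n_comp] counts components only when [connect] is symmetric. *)
Lemma adj_connect_sym (G : multigraph) (H : factor G) (S : {set G}) :
  connect_sym (adj H S).
Proof.
apply: sym_connect_sym => x y; rewrite /adj andbCA; congr [&& _, _ & _].
by apply: eq_existsb => e; rewrite setUC.
Qed.

Definition omega (G : multigraph) (H : factor G) (S : {set G}) : nat :=
  n_comp (adj H S) (~: S).

Definition tough (R : realType) (t : R) (G : multigraph) : Prop :=
  0 < t /\
  forall S : {set G}, (omega [set: edge G] S)%:R <= Num.max 1 (t^-1 * #|S|%:R).

Definition connected (G : multigraph) (H : factor G) : Prop :=
  omega H set0 = 1%N.

(* p = [:: (x_0, e_0); ...; (x_n, e_n)] stands for the closed walk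
   x_0 e_0 x_1 ... x_n e_n x_0. Length 1 is impossible since there are no
   loops, whereas two parallel edges form a cycle of length 2. *)
Definition is_cycle (G : multigraph) (H : factor G) (p : seq (G * edge G)) :
  bool :=
  [&& p != [::], uniq (unzip1 p), uniq (unzip2 p),
      all (fun e => e \in H) (unzip2 p) &
      cycle (fun a b => ends a.2 == [set a.1; b.1]) p].

Definition acyclic (G : multigraph) (H : factor G) : Prop :=
  forall p, ~~ is_cycle H p.

Definition spanning_tree (G : multigraph) (T : factor G) : Prop :=
  connected T /\ acyclic T.

Definition tree_connected (G : multigraph) (m : nat) (H : factor G) : Prop :=
  exists T : 'I_m -> factor G,
    [/\ forall i, T i \subset H,
        forall i, spanning_tree (T i)
      & forall i j, i != j -> [disjoint T i & T j]].

(* Main.v *)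
Require Import Defs.
From mathcomp Require Import all_boot all_order all_algebra.
From mathcomp Require Import reals zify.
Set Implicit Arguments.
Unset Strict Implicit.
Unset Printing Implicit Defensive.
Import Order.TTheory GRing.Theory Num.Theory.

(** Raising [f] by [k] at one vertex if necessary, it suffices to prescribe exact
degrees [g] with even sum. Put [M = m + m0 + 1].

A largest set [F] of edges with [|F[X]| <= M (|X| - 1)] for all nonempty [X] and
maximum degree at most [2 M + 1] has [M (|V| - 1)] edges. Otherwise consider the
sets [W] that attain equality and in which every vertex can be made unsaturated
by rearranging [F] inside [W]. The maximal ones are disjoint, [F] contains every
edge between them, and all remaining vertices are saturated; counting shows that
deleting few vertices leaves many components. By Nash-Williams, [F] splits into
[M] spanning trees: [m] of them go to [H], [m0] to its complement, and the last
one, [T], stays available.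

It remains to find a factor with degrees [h = g - d_{T_1, ..., T_m}] in what is
left. This is a perfect matching problem in a gadget graph, and a Tutte-Berge
barrier there gives disjoint sets [S], [T'] of vertices violating Tutte's
condition, in which the number of components is controlled by the tree [T]; when
both sets are empty connectedness and parity suffice. Toughness bounds the number
of vertices of [T'] with few edges avoiding [S] in terms of [|S|]. *)

(** A spanning tree T among the available edges breaks into at most 1 + sum of (d_T(v) - 1) pieces
    when the vertices v of S and T' are deleted, so each of these vertices costs only d_T(v) - 1 in
    the count of components. This is why one tree more than required is packed, and why the degree
    bound is imposed on the whole packing: what H has already used at v, together with d_T(v), must
    stay well below g(v).

    The packing is sought as a single sparse set because |F[X]| is supermodular: sets with equality
    that intersect can be united and intersected, and edges can be exchanged inside them, which
    makes augmentation under a degree bound possible.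

    The constant 4 b^2 serves twice. As b >= 7 M, it exceeds the 4 M^2 and 8 M^2 that the packing
    asks of the toughness and of |V|. In the degree condition, vertices of T' with few edges
    avoiding S cost at most 2 b each, each vertex of S offers a surplus of 4, and this toughness
    makes the former rare enough. *)

(** * Matchings *)

(* [lia] alone does not return in contexts with many hypotheses about sets. *)
Ltac arith :=
  try match goal with |- @eq ?T ?a ?b => unify T nat; change (@eq nat a b) end;
  repeat match goal with
  | H : is_true (leq _ _) |- _ => revert H
  | H : @eq ?T _ _ |- _ => unify T nat; revert H
  end;
  unfold reverse_coercion;
  repeat match goal with
  | |- context [@card.body ?T ?A] => generalize (@card.body T A)
  end;
  clear; lia.

Section Matching.

Variables (T : finType) (e : rel T).
Hypothesis e_sym : symmetric e.

Implicit Types (A B : {set T}) (s : {ffun T -> T}).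

Definition restrict (A : {set T}) : rel T :=
  fun x y => [&& x \in A, y \in A & e x y].

(* A matching is encoded by the involution exchanging the matched vertices. *)
Definition matching (A : {set T}) (s : {ffun T -> T}) : bool :=
  [forall x, (s (s x) == x) && ((s x != x) ==> (x \in A) && e x (s x))].

Definition unmatched (A : {set T}) (s : {ffun T -> T}) : {set T} :=
  [set x in A | s x == x].

Definition maximum_matching (A : {set T}) (s : {ffun T -> T}) : bool :=
  matching A s &&
  [forall s', matching A s' ==> (#|unmatched A s| <= #|unmatched A s'|)].

Lemma matchingP A s :
  reflect (involutive s /\ forall x, s x != x -> x \in A /\ e x (s x))
          (matching A s).
Proof.
apply: (iffP forallP) => [H | [sK H] x].
  split=> [x | x sx]; first by case/andP: (H x) => /eqP.
  by case/andP: (H x) => _ /implyP/(_ sx)/andP.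
by rewrite sK eqxx /=; apply/implyP => /H[-> ->].
Qed.

Lemma maximum_matchingP A s :
  reflect (matching A s /\
           forall s', matching A s' -> #|unmatched A s| <= #|unmatched A s'|)
          (maximum_matching A s).
Proof.
apply: (iffP andP) => [[ms /forallP H] | [ms H]]; split=> //.
  by move=> s' ms'; apply: (implyP (H s')).
by apply/forallP => s'; apply/implyP/H.
Qed.

Lemma card_fixfree_involution (s : T -> T) (B : {set T}) :
  involutive s -> (forall x, x \in B -> s x \in B /\ s x != x) -> ~~ odd #|B|.
Proof.
move=> sK; have [n] := ubnP #|B|; elim: n B => // n IHn B ltBn sB.
have [->|[x xB]] := set_0Vmem B; first by rewrite cards0.
have [sxB sx] := sB x xB.
have cB : #|B| = (#|B :\ x :\ s x|).+2.
  by rewrite (cardsD1 x) xB (cardsD1 (s x)) !inE sx sxB.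
rewrite cB /= negbK; apply: IHn; first by arith.
move=> y; rewrite !inE => /and3P[ysx yx yB]; have [syB sy] := sB y yB.
split=> //; rewrite syB andbT; apply/andP; split.
  by apply: contra yx => /eqP/(can_inj sK)->.
by apply: contra ysx => /eqP <-; rewrite sK.
Qed.

Lemma odd_unmatched A s : matching A s -> odd #|unmatched A s| = odd #|A|.
Proof.
move=> /matchingP[sK sA].
have sub : unmatched A s \subset A by apply/subsetP => x; rewrite inE => /andP[].
rewrite -(cardsID (unmatched A s) A) (setIidPr sub) oddD.
suff /negbTE-> : ~~ odd #|A :\: unmatched A s| by rewrite addbF.
apply: (card_fixfree_involution sK) => x; rewrite !inE negb_and => /andP[+ xA].
rewrite xA /= => sx; split=> //.
have ssx : s (s x) != s x by rewrite sK eq_sym.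
have [-> _] := sA _ ssx; by rewrite ssx.
Qed.

Lemma exists_maximum_matching A : exists s, maximum_matching A s.
Proof.
pose s0 : {ffun T -> T} := [ffun x => x].
have ms0 : matching A s0 by apply/matchingP; split=> x; rewrite !ffunE ?eqxx.
have [s ms smin] := arg_minnP (fun s => #|unmatched A s|) ms0.
by exists s; apply/maximum_matchingP.
Qed.

Lemma maximum_matching_card A s s' :
  maximum_matching A s -> maximum_matching A s' ->
  #|unmatched A s| = #|unmatched A s'|.
Proof.
move=> /maximum_matchingP[ms H] /maximum_matchingP[ms' H'].
by apply/eqP; rewrite eqn_leq H ?H'.
Qed.

Lemma maximum_matching_edge A s x y :
  maximum_matching A s -> x \in unmatched A s -> y \in unmatched A s ->
  x != y -> ~~ e x y.
Proof.
move=> /maximum_matchingP[/matchingP[sK sA] smax] xU yU xy; apply/negP => exy.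
move: (xU) (yU); rewrite !inE => /andP[xA /eqP sx] /andP[yA /eqP sy].
pose s' : {ffun T ->
  T} := [ffun w => if w == x then y else if w == y then x else s w].
have E w : s' w = if w == x then y else if w == y then x else s w by rewrite ffunE.
have ms' : matching A s'.
  apply/matchingP; split=> w; rewrite !E.
    case: (eqVneq w x) => [->|wx]; first by rewrite (eq_sym y) (negbTE xy) eqxx.
    case: (eqVneq w y) => [->|wy]; first by rewrite eqxx.
    have swx : s w != x by apply: contra wx => /eqP h; rewrite -(sK w) h sx.
    have swy : s w != y by apply: contra wy => /eqP h; rewrite -(sK w) h sy.
    by rewrite (negbTE swx) (negbTE swy) sK.
  case: (eqVneq w x) => [->|wx] //.
  case: (eqVneq w y) => [->|wy]; first by rewrite e_sym.
  exact: sA.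
have := smax _ ms'; apply/negP; rewrite -ltnNge; apply: proper_card.
apply/properP; split; last first.
  by exists x; rewrite // inE E eqxx eq_sym (negbTE xy) andbF.
apply/subsetP => w; rewrite !inE E => /andP[-> /=].
case: (eqVneq w x) => [->|wx]; first by rewrite eq_sym (negbTE xy).
by case: (eqVneq w y) => [->|wy] //; rewrite (negbTE xy).
Qed.

(** Rotation: [x] takes [y] away from its partner [s y], which becomes unmatched in place of [x], so
    the number of unmatched vertices does not grow. *)
Lemma maximum_matching_switch A s x y :
  maximum_matching A s -> x \in unmatched A s -> y \in A -> s y != y -> e x y ->
  exists2 s', maximum_matching A s' &
    [/\ s' x = y, s' y = x, s' (s y) = s y
      & forall w, w != x -> w != y -> w != s y -> s' w = s w].
Proof.
move=> /maximum_matchingP[/matchingP[sK sA] smax].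
rewrite inE => /andP[xA /eqP sx] yA sy exy.
have xy : x != y by apply: contra sy => /eqP <-; rewrite sx.
have syx : s y != x.
  by apply: contra xy => /eqP h; rewrite -(sK y) h sx eqxx.
pose s' : {ffun T -> T} :=
  [ffun w => if w == x then y else if w == y then x else if w == s y then w else s w].
have E w : s' w = if w == x then y else if w == y then x
                  else if w == s y then w else s w by rewrite ffunE.
have ms' : matching A s'.
  apply/matchingP; split=> w; rewrite !E.
    case: (eqVneq w x) => [->|wx]; first by rewrite (eq_sym y) (negbTE xy) eqxx.
    case: (eqVneq w y) => [->|wy]; first by rewrite eqxx.
    case: (eqVneq w (s y)) => [->|wsy].
      by rewrite (negbTE syx) (negbTE sy) eqxx.
    have swx : s w != x by apply: contra wx => /eqP h; rewrite -(sK w) h sx.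
    have swy : s w != y by apply: contra wsy => /eqP <-; rewrite sK.
    by rewrite (negbTE swx) (negbTE swy) (inj_eq (can_inj sK)) (negbTE wy) sK.
  case: (eqVneq w x) => [->|wx] //.
  case: (eqVneq w y) => [->|wy]; first by rewrite e_sym.
  by case: (eqVneq w (s y)) => [->|wsy]; [rewrite eqxx | exact: sA].
exists s'; last first.
  split; rewrite ?E ?eqxx //.
  - by rewrite eq_sym (negbTE xy).
  - by rewrite (negbTE syx) (negbTE sy).
  - by move=> w wx wy wsy; rewrite E (negbTE wx) (negbTE wy) (negbTE wsy).
apply/maximum_matchingP; split=> // s'' /smax; apply: leq_trans.
have sub : unmatched A s' \subset s y |: (unmatched A s :\ x).
  apply/subsetP => w; rewrite !inE E => /andP[-> /=].
  case: (eqVneq w x) => [->|wx]; first by rewrite eq_sym (negbTE xy).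
  case: (eqVneq w y) => [->|wy]; first by rewrite (negbTE xy).
  by case: (eqVneq w (s y)).
apply: (leq_trans (subset_leq_card sub)); apply: (leq_trans (leq_card_setU _ _)).
by rewrite cards1 (cardsD1 x (unmatched A s)) inE xA sx eqxx.
Qed.

Definition agreement (s s' : {ffun T -> T}) : nat := #|[set x | s x == s' x]|.

(* Gallai's lemma. The induction is on a path joining the two vertices; an
   inner vertex [t] of the path is missed by a maximum matching, which is
   chosen to agree with [s] as much as possible. *)
Lemma gallai A s u v :
  (forall x, x \in A -> exists2 s', maximum_matching A s' & s' x = x) ->
  maximum_matching A s -> u \in unmatched A s -> v \in unmatched A s ->
  u != v -> ~~ connect (restrict A) u v.
Proof.
move=> miss mxs uU vU uv; apply/negP => /connectP[p].
elim: p => [|t p IHp] in s u uv mxs uU vU *.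
  by move=> _ vu; rewrite vu eqxx in uv.
rewrite /= => /andP[/and3P[uA tA eut] pth] lastp.
have [tu|tu] := eqVneq t u.
  by rewrite tu in pth lastp; apply: (IHp s u uv).
have [tv|tv] := eqVneq t v.
  by have := maximum_matching_edge mxs uU vU uv; rewrite -tv eut.
have [s0 mxs0 s0t] := miss t tA.
pose P s' := maximum_matching A s' && (s' t == t).
have Ps0 : P s0 by rewrite /P mxs0 s0t eqxx.
have [N /andP[mxN /eqP Nt] Nmax] := arg_maxnP (agreement s) Ps0.
have tN : t \in unmatched A N by rewrite inE tA Nt eqxx.
have vN : v \notin unmatched A N by apply/negP => vN; apply: (IHp N t tv).
have uN : u \notin unmatched A N.
  apply/negP => uN; have := maximum_matching_edge mxN uN tN.
  by rewrite eq_sym tu eut => /(_ isT).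
have [/matchingP[sK sA] _] := maximum_matchingP _ _ mxs.
have [/matchingP[NK NA] _] := maximum_matchingP _ _ mxN.
have tU : t \notin unmatched A s.
  apply/negP => tU; have := maximum_matching_edge mxs uU tU.
  by rewrite eq_sym tu eut => /(_ isT).
(* [s] and [N] leave equally many vertices unmatched. Only [s] misses [u] and [v], only [N] misses
   [t], so [N] misses a further vertex that [s] covers. *)
have [x] : exists x, x \in unmatched A N :\: unmatched A s :\ t.
  apply/set0Pn; rewrite -card_gt0.
  have := maximum_matching_card mxs mxN.
  rewrite -(cardsID (unmatched A N) (unmatched A s)).
  rewrite -(cardsID (unmatched A s) (unmatched A N)) setIC => /addnI.
  rewrite (cardsD1 t (_ :\: unmatched A s)) !inE.
  move: tN tU; rewrite !inE => -> -> /= E.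
  suff : 2 <= #|unmatched A s :\: unmatched A N| by rewrite E ltnS.
  have <- : #|[set u; v]| = 2 by rewrite cards2 uv.
  apply: subset_leq_card.
  by apply/subsetP => w; rewrite in_set2 in_setD => /orP[]/eqP->; rewrite ?uN ?vN.
rewrite in_setD1 in_setD => /and3P[xt xU xN].
move: (xN); rewrite inE => /andP[xA /eqP Nx].
have sx : s x != x by move: xU; rewrite inE xA.
have [_ exy] := sA x sx; set y := s x in exy sx.
have ssy : s y != y by rewrite sK eq_sym.
have [yA _] := sA _ ssy.
have Ny : N y != y.
  apply/negP => Ny; have yN : y \in unmatched A N by rewrite inE yA.
  by have := maximum_matching_edge mxN xN yN; rewrite eq_sym sx exy => /(_ isT).
(* Rotating [N] so that it uses the edge of [s] at [x] gains agreement with [s], loses none, and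
   still misses [t]. *)
have [N' mxN' [N'x N'y N'z N'w]] := maximum_matching_switch mxN xN yA Ny exy.
have ty : t != y by apply: contra Ny => /eqP <-; rewrite Nt.
have tNy : t != N y by apply: contra ty => /eqP h; rewrite -(NK y) -h Nt.
have PN' : P N' by rewrite /P mxN' N'w ?Nt ?eqxx // eq_sym.
have := Nmax _ PN'; apply/negP; rewrite -ltnNge; apply: proper_card.
apply/properP; split; last first.
  by exists x; rewrite inE ?N'x ?Nx // eqxx.
apply/subsetP => w; rewrite !inE => /eqP sw; apply/eqP.
have [->|wx] := eqVneq w x; first by rewrite N'x.
have [->|wy] := eqVneq w y; first by rewrite N'y sK.
have [wNy|wNy] := eqVneq w (N y); last by rewrite N'w.
by case/eqP: wx; rewrite -(sK x) -/y -(NK y) -wNy -sw sK.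
Qed.

Lemma matching_setD1 A s v : matching (A :\ v) s -> matching A s /\ s v = v.
Proof.
move=> /matchingP[sK sA]; split.
  by apply/matchingP; split=> // x /sA[]; rewrite !inE => /andP[].
by apply/eqP/negPn/negP => /sA[]; rewrite !inE eqxx.
Qed.

(** Instead of odd components, the barrier comes with unmatched vertices lying in distinct
    components. If every vertex is missed by some maximum matching, Gallai's lemma makes the empty
    barrier work. Otherwise some [v] is covered by all of them and joins the barrier: a matching
    missing [v] is not maximum, so by parity it leaves at least two more vertices unmatched, only
    one of which is [v]. *)
Theorem tutte_berge A d :
  (forall s, matching A s -> d <= #|unmatched A s|) ->
  exists (Z : {set T}) s, [/\ Z \subset A, matching (A :\: Z) s,
    #|Z| + d <= #|unmatched (A :\: Z) s|
    & {in unmatched (A :\: Z) s &, forall u v,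
         u != v -> ~~ connect (restrict (A :\: Z)) u v}].
Proof.
have [n] := ubnP #|A|; elim: n A d => // n IHn A d ltAn dA.
case: (boolP [forall x in A, [exists s', maximum_matching A s' && (s' x == x)]]).
  move=> /forall_inP H; have [s mxs] := exists_maximum_matching A.
  have [ms _] := maximum_matchingP _ _ mxs.
  exists set0, s; rewrite sub0set setD0 cards0 dA //; split=> // u v uU vU.
  apply: (gallai _ mxs) => // x /H/existsP[s' /andP[mxs' /eqP]]; by exists s'.
rewrite negb_forall_in => /exists_inP[v vA /existsPn H].
have [s mxs] := exists_maximum_matching A.
have [ms smin] := maximum_matchingP _ _ mxs.
have cA : #|A| = #|A :\ v|.+1 by rewrite (cardsD1 v) vA.
case: (IHn (A :\ v) d.+1); first by arith.
  move=> s' ms'; have [ms'A s'v] := matching_setD1 ms'.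
  have cU : #|unmatched A s'| = #|unmatched (A :\ v) s'|.+1.
    rewrite (cardsD1 v) inE vA s'v eqxx /=; congr _.+1; apply: eq_card => x.
    by rewrite !inE andbA.
  have := smin _ ms'A; rewrite leq_eqVlt => /orP[/eqP E|lt].
    case/negP: (H s'); rewrite s'v eqxx andbT; apply/maximum_matchingP; split=> //.
    by rewrite -E.
  have := dA _ ms; have := odd_unmatched ms; have := odd_unmatched ms'A; arith.
move=> Z [s' [ZA ms' cZ sep]]; exists (v |: Z), s'.
have -> : A :\: (v |: Z) = A :\ v :\: Z by rewrite setDDl.
split=> //.
  by rewrite subUset sub1set vA (subset_trans ZA) // subD1set.
rewrite cardsU1; case: (v \in Z) => /=; arith.
Qed.

End Matching.

(** * Sparse edge sets and tree packings *)

Section Sparse.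

Variable G : multigraph.
Implicit Types (F K : factor G) (X Y W : {set G}) (e : edge G) (x y u v : G).

Definition inside F X : factor G := [set e in F | ends e \subset X].

(** The bound |F[X]| <= M (|X| - 1) without truncated subtraction; for M = 1 it describes
    forests. *)
Definition sparse (M : nat) F : bool :=
  [forall X, (X != set0) ==> (#|inside F X| + M <= M * #|X|)].

Lemma sparseP M F :
  reflect (forall X, X != set0 -> #|inside F X| + M <= M * #|X|) (sparse M F).
Proof.
apply: (iffP forallP) => H X; first exact: (implyP (H X)).
by apply/implyP/H.
Qed.

Lemma in_inside F X e : (e \in inside F X) = (e \in F) && (ends e \subset X).
Proof. by rewrite inE. Qed.

Lemma insideT F : inside F setT = F.
Proof. by apply/setP => e; rewrite in_inside subsetT andbT. Qed.

Lemma insideS F K X : F \subset K -> inside F X \subset inside K X.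
Proof.
by move=> /subsetP FK; apply/subsetP => e; rewrite !in_inside => /andP[/FK-> ->].
Qed.

Lemma inside_subset F X Y : X \subset Y -> inside F X \subset inside F Y.
Proof.
move=> XY; apply/subsetP => e; rewrite !in_inside => /andP[-> eX].
exact: subset_trans XY.
Qed.

Lemma card_insideS F K X : F \subset K -> #|inside F X| <= #|inside K X|.
Proof. by move=> FK; apply/subset_leq_card/insideS. Qed.

Lemma sparseS M F K : F \subset K -> sparse M K -> sparse M F.
Proof.
move=> FK /sparseP sK; apply/sparseP => X /sK; apply: leq_trans.
by rewrite leq_add2r card_insideS.
Qed.

Lemma card_insideUI F X Y :
  #|inside F X| + #|inside F Y| <= #|inside F (X :&: Y)| + #|inside F (X :|: Y)|.
Proof.
rewrite -cardsUI addnC leq_add //; apply: subset_leq_card; apply/subsetP => e.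
  by rewrite !inE => /andP[/andP[-> eX] /andP[_ eY]]; rewrite subsetI eX eY.
rewrite !inE => /orP[]/andP[-> /subset_trans->] //;
  [exact: subsetUl|exact: subsetUr].
Qed.

Lemma ends_eq e u v : u \in ends e -> v \in ends e -> u != v -> ends e = [set u; v].
Proof.
move=> ue ve uv; apply/esym/eqP; rewrite eqEcard cards2 uv ends_card leqnn andbT.
by apply/subsetP => w; rewrite !inE => /orP[]/eqP->.
Qed.

Lemma ends_subset2 e u v X : ends e = [set u; v] ->
  (ends e \subset X) = (u \in X) && (v \in X).
Proof. by move=> ->; rewrite subUset !sub1set. Qed.

Lemma ends_set2 e : exists u v, ends e = [set u; v] /\ u != v.
Proof.
by have /eqP/cards2P[u [v [uv E]]] := ends_card e; exists u, v.
Qed.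

(* The tree [T] spans [R]; it is extended by an edge leaving [R] within a
   smallest set [X] for which the last inequality is an equality. *)
Lemma sparse_grow_tree M F (R : {set G}) (T : factor G) :
    sparse M.+1 F -> #|F| + M.+1 = M.+1 * #|[set: G]| ->
    R != set0 -> T \subset F -> (forall e, e \in T -> ends e \subset R) ->
    #|T| + 1 = #|R| -> sparse 1 T ->
    (forall X, X :&: R != set0 ->
      #|inside (F :\: T) X| + #|X :&: R| + M.+1 <= M.+1 * #|X| + 1) ->
  exists T' : factor G, [/\ T' \subset F, sparse 1 T', #|T'| + 1 = #|[set:
    G]| & sparse M (F :\: T')].
Proof.
move=> sF cF; have [n] := ubnP #|~: R|.
elim: n => // n IHn in R T * => ltR R0 TF TR cT sT inv.
have [RT|RT] := eqVneq R setT.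
  exists T; split=> //; first by rewrite cT RT.
  apply/sparseP => X X0; move: (inv X); rewrite RT setIT => /(_ X0).
  by move: X0; rewrite -card_gt0; arith.
set K := F :\: T in inv *.
have sK : sparse M.+1 K by apply: sparseS sF; apply: subsetDl.
have [w wR] : exists w, w \notin R.
  by apply/existsP; move: RT; apply: contraNT; rewrite negb_exists => /forallP H;
     apply/eqP/setP => z; rewrite inE; apply/negPn/H.
(* Sets reaching outside [R] on which the invariant has no slack; [setT] is one because [F] has the
   full number of edges. *)
pose crit X := [&& X :&: R != set0, ~~ (X \subset R) &
   #|inside K X| + #|X :&: R| + M.+1 == M.+1 * #|X| + 1].
have critT : crit setT.
  rewrite /crit setTI R0 insideT /= -cT cardsD (setIidPr TF).
  have := subset_leq_card TF; rewrite subTset RT /=. arith.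
have [X /and3P[XR XnR /eqP cX] Xmin] := arg_minnP (fun X => #|X|) critT.
(* Otherwise the edges of [K] in [X] split between [X :&: R] and [X :\: R]; the invariant on the
   former and sparsity on the latter then miss the equality by M + 1. *)
have [e eX /andP[e1 e2]] : exists2 e, e \in inside K X
    & ~~ (ends e \subset X :&: R) && ~~ (ends e \subset X :\: R).
  apply/exists_inP; rewrite -[X in is_true X]negbK negb_exists_in;
    apply/negP => /forall_inP H.
  have : #|inside K X| <= #|inside K (X :&: R)| + #|inside K (X :\: R)|.
    apply: leq_trans (leq_card_setU _ _); apply/subset_leq_card/subsetP => e eX.
    have := H e eX; rewrite negb_and !negbK in_setU !in_inside.
    by move: eX; rewrite in_inside => /andP[-> _].
  have := inv (X :&: R); rewrite -setIA setIid => /(_ XR).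
  have XDR : X :\: R != set0 by rewrite setD_eq0.
  have := sparseP _ _ sK _ XDR.
  have : M.+1 * #|X| = M.+1 * #|X :&: R| + M.+1 * #|X :\: R|.
    by rewrite -mulnDr cardsID.
  arith.
move: (eX); rewrite in_inside => /andP[eK eXs].
have [v ve vR] : exists2 v, v \in ends e & v \notin R.
  by apply/subsetPn; move: e1; rewrite subsetI eXs.
have [u ue uR] : exists2 u, u \in ends e & u \in R.
  have /subsetPn[u ue] := e2; rewrite inE (subsetP eXs) // andbT negbK => uR.
  by exists u.
have uv : u != v by apply: contra vR => /eqP <-.
have Ee := ends_eq ue ve uv.
have uX := subsetP eXs u ue; have vX := subsetP eXs v ve.
have [eF eT] : e \in F /\ e \notin T by move: eK; rewrite inE => /andP[-> ->].
apply: (IHn (v |: R) (e |: T)).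
- move: ltR; rewrite (cardsD1 v (~: R)) inE vR ltnS; apply: leq_trans; rewrite ltnS.
  apply/subset_leq_card/subsetP => z; by rewrite !inE negb_or.
- by apply/set0Pn; exists v; rewrite setU11.
- by rewrite subUset sub1set eF.
- move=> e'; rewrite in_setU1 => /orP[/eqP->|/TR e'R].
    by rewrite (ends_subset2 _ Ee) !inE uR eqxx orbT.
  by apply: (subset_trans e'R); apply: subsetUr.
- by rewrite !cardsU1 eT vR -cT; arith.
- apply/sparseP => Y Y0; case: (boolP (ends e \subset Y)) => eY; last first.
    apply: leq_trans (sparseP _ _ sT Y Y0); rewrite leq_add2r.
    apply/subset_leq_card/subsetP => e'; rewrite !in_inside in_setU1.
    by case/andP=> /orP[/eqP->|-> ->//]; rewrite (negbTE eY).
  have [uY vY] : u \in Y /\ v \in Y by apply/andP; rewrite -(ends_subset2 _ Ee).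
  have Y'0 : Y :\ v != set0 by apply/set0Pn; exists u; rewrite !inE uv.
  have := sparseP _ _ sT _ Y'0; rewrite (cardsD1 v Y) vY.
  (* [v] is a leaf of the new tree: no edge of [T] reaches it, so removing [v] from [Y] loses only
     [e]. *)
  suff : #|inside (e |: T) Y| <= #|inside T (Y :\ v)| + 1 by arith.
  rewrite addnC -(cards1 e); apply: leq_trans (leq_card_setU _ _).
  apply/subset_leq_card/subsetP => e'; rewrite in_inside in_setU1 in_setU in_set1.
  case: eqP => //= _ /andP[e'T e'Y]; rewrite in_inside e'T subsetD1 e'Y /=.
  by apply: contra vR => ve'; apply: (subsetP (TR _ e'T)).
move=> Y YR.
have -> : F :\: (e |: T) = K :\ e by rewrite setUC setDDl.
have leK : #|inside (K :\ e) Y| <= #|inside K Y| by apply/card_insideS/subD1set.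
case: (boolP (v \in Y)) => vY; last first.
  have E : Y :&: (v |: R) = Y :&: R.
    apply/setP => z; rewrite !inE; case: eqP => //= ->; by rewrite (negbTE vY).
  by rewrite E in YR *; apply: leq_trans (inv Y YR); rewrite !leq_add2r.
have -> : #|Y :&: (v |: R)| = #|Y :&: R|.+1.
  rewrite (cardsD1 v) !inE vY eqxx /=; congr _.+1; apply: eq_card => z.
  by rewrite !inE; case: eqP => // ->; rewrite (negbTE vR) andbF.
(* The old invariant does not speak of sets missing [R]; for them sparsity of [K] gives exactly the
   new bound. *)
have [YR0|{}YR] := eqVneq (Y :&: R) set0.
  have Y0 : Y != set0 by apply/set0Pn; exists v.
  by have := sparseP _ _ sK Y Y0; rewrite YR0 cards0; arith.
have invY := inv Y YR.
case: (boolP (ends e \subset Y)) => eY.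
  suff : #|inside (K :\ e) Y| < #|inside K Y| by arith.
  apply/proper_card/properP; split; first exact/insideS/subD1set.
  by exists e; rewrite in_inside ?eK // !inE eqxx.
have uY : u \notin Y by move: eY; rewrite (ends_subset2 _ Ee) vY andbT.
(* Only equality in the old invariant could break the new one. Uncrossing [Y] with [X] then gives
   equality on [X :&: Y], which contains [v] but not [u] and is smaller than [X]. *)
suff : #|inside K Y| + #|Y :&: R| + M.+1 <> M.+1 * #|Y| + 1 by arith.
move=> cY.
have sup := card_insideUI K X Y.
have cM : M.+1 * #|X| + M.+1 * #|Y| = M.+1 * #|X :&: Y| + M.+1 * #|X :|: Y|.
  by rewrite -!mulnDr [in RHS]addnC cardsUI.
have cR : #|X :&: R| + #|Y :&: R| = #|X :&: Y :&: R| + #|(X :|: Y) :&: R|.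
  by rewrite setIUl setIIl [RHS]addnC cardsUI.
have invU : #|inside K (X :|: Y)| + #|(X :|: Y) :&: R| + M.+1 <= M.+1 * #|X :|:
  Y| + 1.
  apply: inv; apply: contra XR; rewrite -!subset0; apply: subset_trans.
  by rewrite setSI // subsetUl.
(* If the intersection misses [R], the same count exceeds the sparsity bound on it by one. *)
have [I0|I0] := eqVneq (X :&: Y :&: R) set0.
  have XY0 : X :&: Y != set0 by apply/set0Pn; exists v; rewrite inE vX.
  by have := sparseP _ _ sK _ XY0; rewrite I0 cards0 in cR; arith.
have invI := inv _ I0.
have : crit (X :&: Y).
  rewrite /crit I0 /=; apply/andP; split; last by apply/eqP; arith.
  by apply/subsetPn; exists v; rewrite // inE vX.
move=> /Xmin; apply/negP; rewrite -ltnNge; apply/proper_card/properP.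
by split; [exact: subsetIl | exists u; rewrite // inE uX].
Qed.

Lemma sparse_extract_tree M F : 0 < #|[set: G]| ->
    sparse M.+1 F -> #|F| + M.+1 = M.+1 * #|[set: G]| ->
  exists T : factor G, [/\ T \subset F, sparse 1 T, #|T| + 1 = #|[set:
    G]| & sparse M (F :\: T)].
Proof.
move=> /card_gt0P[r _] sF cF.
apply: (@sparse_grow_tree M F [set r] set0) => //.
- by apply/set0Pn; exists r; rewrite set11.
- by rewrite sub0set.
- by move=> e; rewrite inE.
- by rewrite cards0 cards1.
- apply/sparseP => X X0; rewrite mul1n.
  have -> : inside set0 X = set0 by apply/setP => e; rewrite in_inside !inE.
  by rewrite cards0 add0n card_gt0.
move=> X X0; rewrite setD0.
have : #|X :&: [set r]| <= 1 by rewrite -(cards1 r) subset_leq_card ?subsetIr.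
have X0' : X != set0 by apply: contraNneq X0 => ->; rewrite set0I.
have := sparseP _ _ sF X X0'; arith.
Qed.

(** Removing the extracted tree leaves a set that is sparse and of full size for the next smaller M,
    so trees can be peeled off one at a time. *)
Theorem nash_williams M F : 0 < #|[set: G]| ->
    sparse M F -> #|F| + M = M * #|[set: G]| ->
  exists T : nat -> factor G,
    [/\ forall i, i < M -> T i \subset F,
        forall i, i < M -> sparse 1 (T i) /\ #|T i| + 1 = #|[set: G]|
      & forall i j, i < j < M -> [disjoint T i & T j]].
Proof.
move=> G0; elim: M F => [|M IHM] F sF cF.
  by exists (fun _ => set0); split=> // i j; rewrite ltn0 andbF.
have [T0 [T0F sT0 cT0 sFT]] := sparse_extract_tree G0 sF cF.
have cFT : #|F :\: T0| + M = M * #|[set: G]|.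
  by rewrite cardsD (setIidPr T0F); have := subset_leq_card T0F; arith.
have [T [TF Tt Td]] := IHM _ sFT cFT.
exists (fun i => if i is j.+1 then T j else T0); split.
- case=> // i; rewrite ltnS => /TF; move/subset_trans; apply; exact: subsetDl.
- case=> // i; rewrite ltnS; exact: Tt.
case=> [|i] [|j] //=; rewrite !ltnS; last exact: Td.
move=> /TF; rewrite subsetD disjoint_sym => /andP[_]; by [].
Qed.

(** A proper component and its complement would together span at most |V| - 2 edges. *)
Lemma sparse1_connected T : 0 < #|[set: G]| -> sparse 1 T ->
  #|T| + 1 = #|[set: G]| -> connected T.
Proof.
move=> /card_gt0P[x _] /sparseP sT cT.
pose Q := [set y | connect (adj T set0) x y].
have xQ : x \in Q by rewrite inE connect0.
suff QT : Q = setT.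
  rewrite /connected /omega.
  rewrite -(n_comp_connect (adj_connect_sym T set0) x); apply: eq_n_comp_r => y.
  by have := in_setT y; rewrite -QT !inE => ->.
apply/eqP/contraT => nQ.
have Q0 : Q != set0 by apply/set0Pn; exists x.
have nQ0 : ~: Q != set0 by apply: contra nQ => /eqP E; rewrite -(setCK Q) E setC0.
have := sT Q Q0; have := sT _ nQ0; rewrite !mul1n.
suff : #|T| <= #|inside T Q| + #|inside T (~: Q)|.
  by have := cardsC Q; rewrite -cardsT; arith.
apply: leq_trans (leq_card_setU _ _); apply/subset_leq_card/subsetP => e eT.
have [u [v [Ee uv]]] := ends_set2 e.
rewrite in_setU !in_inside eT /= !(ends_subset2 _ Ee) !inE.
suff -> : connect (adj T set0) x u = connect (adj T set0) x v by case: connect.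
apply/same_connect_r; first exact: adj_connect_sym.
apply: connect1; rewrite /adj !inE /=; apply/exists_inP; exists e => //; exact/eqP.
Qed.

(** A cycle has as many edges as vertices, one more than sparsity allows on its vertex set. *)
Lemma sparse1_acyclic T : sparse 1 T -> acyclic T.
Proof.
move=> /sparseP sT p; apply/negP => /and5P[p0 U1 U2 /allP pT pC].
pose X := [set x in unzip1 p].
have X0 : X != set0 by case: p p0 @X {U1 U2 pT pC} => // a p _; apply/set0Pn;
  exists a.1; rewrite inE in_cons eqxx.
have cX : #|X| = size p by rewrite cardsE (card_uniqP U1) size_map.
have := sT X X0; rewrite cX mul1n.
suff : size p <= #|inside T X| by arith.
rewrite -(size_map snd p) -(card_uniqP U2); apply/subset_leq_card/subsetP => e ep.
rewrite in_inside pT //=; case/mapP: ep => a ap ->.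
have /eqP-> := next_cycle pC ap.
by rewrite subUset !sub1set !inE !map_f // mem_next.
Qed.

End Sparse.

(** * Rearranging a sparse set of bounded degree *)

Section DegreeBound.

Variables (G : multigraph) (M h : nat).
Implicit Types (F K : factor G) (X Y W A B D : {set G}) (e : edge G) (x y u v : G).

Definition tight F W : bool := #|inside F W| + M == M * #|W|.

Definition agree_outside W F F' : bool :=
  [forall e, (ends e \subset W) || ((e \in F') == (e \in F))].

Lemma agree_outsideP W F F' :
  reflect (forall e, ~~ (ends e \subset W) -> (e \in F') = (e \in F))
          (agree_outside W F F').
Proof.
apply: (iffP forallP) => H e; first by move/negbTE => We; move: (H e);
  rewrite We => /eqP.
by case: (boolP (ends e \subset W)) => //= /H ->.
Qed.

Lemma card_inside_agree W F F' Y :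
  agree_outside W F F' -> #|inside F' W| = #|inside F W| -> W \subset Y ->
  #|inside F' Y| = #|inside F Y|.
Proof.
move=> /agree_outsideP ag cW WY.
have E K : #|inside K Y| = #|inside K W| + #|inside K Y :\: inside setT W|.
  rewrite -(cardsID (inside setT W)); congr (_ + _); apply: eq_card => e.
  rewrite in_setI !in_inside in_setT; case: (boolP (ends e \subset W));
    rewrite ?andbF //=.
  by move=> eW; rewrite (subset_trans eW WY) !andbT.
rewrite !E cW; congr (_ + _); apply: eq_card => e.
rewrite !in_setD !in_inside in_setT /=.
by case: (boolP (ends e \subset W)) => //= /ag ->.
Qed.

Lemma ends_neq0 e : ends e != set0.
Proof. by rewrite -card_gt0 ends_card. Qed.

(** Uncrossing with [W]: edges of [X] not inside [W] fit into the room that the tight set [W] leaves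
    in [X :|: W]; the others are bounded by the hypothesis on [X :&: W]. *)
Lemma sparse_replace W F F' :
  sparse M F -> tight F W -> agree_outside W F F' ->
  (forall X, X != set0 -> X \subset W -> #|inside F' X| + M <= M * #|X|) ->
  sparse M F'.
Proof.
move=> /sparseP sF /eqP tW /agree_outsideP ag sW; apply/sparseP => X X0.
have [XW|XW] := eqVneq (X :&: W) set0.
  rewrite (_ : inside F' X = inside F X); first exact: sF.
  apply/setP => e; rewrite !in_inside; case: (boolP (ends e \subset X));
    rewrite ?andbF //.
  move=> eX; rewrite ag //; apply/negP => eW; case/negP: (ends_neq0 e).
  by rewrite -subset0 -XW subsetI eX.
have c1 : #|inside F' X| <= #|inside F' (X :&: W)| + #|inside F X :\:
  inside setT W|.
  apply: leq_trans (leq_card_setU _ _); apply/subset_leq_card/subsetP => e.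
  rewrite in_setU in_setD !in_inside subsetI in_setT /= => /andP[eF eX].
  by rewrite eF eX; case: (boolP (ends e \subset W)) => //= /ag <-; rewrite eF.
have c2 : #|inside F W| + #|inside F X :\: inside setT W| <= #|inside F (X :|: W)|.
  rewrite -[X in _ <= X](cardsID (inside setT W)); apply: leq_add.
    apply/subset_leq_card/subsetP => e;
      rewrite in_setI !in_inside in_setT => /andP[-> eW].
    by rewrite eW (subset_trans eW) ?subsetUr.
  by apply/subset_leq_card/setSD/inside_subset/subsetUl.
have XW0 : X :|: W != set0 by rewrite setU_eq0 (negbTE X0).
have := sF _ XW0; have := sW _ XW (subsetIr _ _).
have : M * #|X| + M * #|W| = M * #|X :&: W| + M * #|X :|: W|.
  by rewrite -!mulnDr [in RHS]addnC cardsUI.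
arith.
Qed.

(** [inside] is supermodular and M |X| is modular, so equality on both sets forces it on union and
    intersection once sparsity applies to the intersection, that is, once it is nonempty. *)
Lemma tightU F A B :
  sparse M F -> tight F A -> tight F B -> A :&: B != set0 -> tight F (A :|: B).
Proof.
move=> /sparseP sF /eqP tA /eqP tB AB; have := sF _ AB.
have /sF : A :|: B != set0.
  by apply: contra AB; rewrite setU_eq0 => /andP[/eqP-> _]; rewrite set0I.
have := card_insideUI F A B.
have : M * #|A| + M * #|B| = M * #|A :&: B| + M * #|A :|: B|.
  by rewrite -!mulnDr [in RHS]addnC cardsUI.
rewrite /tight; arith.
Qed.

Lemma tightI F A B :
  sparse M F -> tight F A -> tight F B -> A :&: B != set0 -> tight F (A :&: B).
Proof.
move=> /sparseP sF /eqP tA /eqP tB AB; have := sF _ AB.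
have /sF : A :|: B != set0.
  by apply: contra AB; rewrite setU_eq0 => /andP[/eqP-> _]; rewrite set0I.
have := card_insideUI F A B.
have : M * #|A| + M * #|B| = M * #|A :&: B| + M * #|A :|: B|.
  by rewrite -!mulnDr [in RHS]addnC cardsUI.
rewrite /tight; arith.
Qed.

Lemma eq_degree F F' v :
  (forall e, v \in ends e -> (e \in F') = (e \in F)) -> degree F' v = degree F v.
Proof.
move=> E; apply: eq_card => e; rewrite !inE.
by case: (boolP (v \in ends e)) => ve; rewrite ?andbF ?andbT ?E.
Qed.

Lemma degreeS F F' v : F \subset F' -> degree F v <= degree F' v.
Proof.
move=> /subsetP FF'; apply/subset_leq_card/subsetP => e; rewrite !inE.
by case/andP=> /FF'->.
Qed.

Lemma degree_setU1 F e v : degree (e |: F) v <= degree F v + (v \in ends e).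
Proof.
have sub : [set e' in e |: F | v \in ends e'] \subset
       [set e' in F | v \in ends e'] :|: [set e' in [set e] | v \in ends e'].
  by apply/subsetP => e'; rewrite !inE -andb_orl orbC.
apply: leq_trans (subset_leq_card sub) _; apply: leq_trans (leq_card_setU _ _) _.
rewrite leq_add2l; case: (boolP (v \in ends e)) => ve.
  rewrite -[nat_of_bool true](cards1 e).
  by apply/subset_leq_card/subsetP => e'; rewrite !inE => /andP[].
rewrite leqn0 cards_eq0; apply/eqP/setP => e'; rewrite !inE.
by case: eqP => //= ->; rewrite (negbTE ve).
Qed.

Definition bounded_sparse F : bool :=
  sparse M F && [forall v, degree F v <= h].

Lemma bounded_sparseP F :
  reflect (sparse M F /\ forall v, degree F v <= h) (bounded_sparse F).
Proof. by apply: (iffP andP) => -[sF] => [/forallP|/forallP]. Qed.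

(** Keeping the number of edges inside [W] keeps [W] tight and leaves the total number of edges
    unchanged. *)
Definition modification W F F' : bool :=
  [&& bounded_sparse F', #|inside F' W| == #|inside F W| & agree_outside W F F'].

Definition good F W : bool :=
  [&& W != set0, tight F W &
      [forall v in W, [exists F', modification W F F' && (degree F' v < h)]]].

Lemma goodP F W :
  reflect [/\ W != set0, tight F W & forall v, v \in W ->
             exists2 F', modification W F F' & degree F' v < h]
          (good F W).
Proof.
apply: (iffP and3P) => -[W0 tW H]; split=> //.
  by move=> v vW; have /existsP[F' /andP[]] := forall_inP H v vW; exists F'.
apply/forall_inP => v vW; apply/existsP; have [F' mF' dF'] := H v vW.
by exists F'; rewrite mF'.
Qed.

Lemma agree_outsideS W Y F F' :
  W \subset Y -> agree_outside W F F' -> agree_outside Y F F'.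
Proof.
move=> WY /agree_outsideP ag; apply/agree_outsideP => e eY; apply: ag.
by apply: contra eY => eW; apply: subset_trans WY.
Qed.

Lemma modificationS W Y F F' :
  W \subset Y -> modification W F F' -> modification Y F F'.
Proof.
move=> WY /and3P[bF' /eqP cW ag].
by rewrite /modification bF' (card_inside_agree ag cW WY) eqxx (agree_outsideS WY).
Qed.

Lemma goodU F A B : sparse M F -> good F A -> good F B -> A :&: B != set0 ->
  good F (A :|: B).
Proof.
move=> sF /goodP[A0 tA gA] /goodP[B0 tB gB] AB; apply/goodP; split.
- by rewrite setU_eq0 (negbTE A0).
- exact: tightU.
move=> v; rewrite inE => /orP[/gA|/gB] [F' mF' dF']; exists F' => //;
  apply: modificationS mF'; [exact: subsetUl | exact: subsetUr].
Qed.

(** A single vertex is tight, as M (1 - 1) = 0; hence every unsaturated vertex lies in a good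
    set. *)
Lemma good_set1 F v : bounded_sparse F -> degree F v < h -> good F [set v].
Proof.
move=> bF dF; apply/goodP; split.
- by apply/set0Pn; exists v; rewrite set11.
- rewrite /tight cards1 muln1 (_ : inside F _ = set0) ?cards0 //.
  apply/setP => e; rewrite in_inside inE; apply/negP => /andP[_ /subset_leq_card].
  by rewrite ends_card cards1.
move=> w; rewrite inE => /eqP->; exists F => //; apply/and3P; split=> //.
by apply/agree_outsideP.
Qed.

(** Otherwise [D :\ v] would span as many edges as [D], which is M too many. *)
Lemma tight_edge F D v : 0 < M -> sparse M F -> tight F D -> v \in D -> 1 < #|D| ->
  exists2 e, e \in inside F D & v \in ends e.
Proof.
move=> M_gt0 /sparseP sF /eqP tD vD D1.
have cD : #|D| = #|D :\ v|.+1 by rewrite (cardsD1 v) vD.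
have D'0 : D :\ v != set0 by rewrite -card_gt0; arith.
have sD' := sF _ D'0.
suff [e eD] : exists2 e, e \in inside F D & e \notin inside F (D :\ v).
  move: (eD); rewrite !in_inside subsetD1 => /andP[-> ->] /=; rewrite negbK => ve.
  by exists e.
apply/subsetPn/negP => /subset_leq_card; arith.
Qed.

(** Exchange along the fundamental circuit of [e] in the sparsity matroid. A tight set containing
    both ends of [e] contains [D], since its intersection with [D] is tight; so it contains [e'],
    whose removal makes room for [e]. *)
Lemma tight_exchange F D e e' x y :
  sparse M F -> x \in D -> y \in D -> tight F D -> ends e = [set x; y] ->
  (forall X, x \in X -> y \in X -> tight F X -> #|D| <= #|X|) ->
  e' \in inside F D -> e \notin F -> sparse M ((e |: F) :\ e').
Proof.
move=> sF xD yD tD Ee Dmin e'D eF; apply/sparseP => X X0.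
have cX := sparseP _ _ sF X X0.
move: (e'D); rewrite in_inside => /andP[e'F e'sD].
have sub : inside ((e |: F) :\ e') X \subset e |: inside F X.
  apply/subsetP => g; rewrite in_inside !in_setU1 in_setD1 in_setU1 in_inside.
  by case: (g == e) => //= /andP[/andP[_ ->] ->].
have [eX|eX] := boolP (ends e \subset X); last first.
  suff : inside ((e |: F) :\ e') X \subset inside F X by move/subset_leq_card;
    arith.
  apply/subsetP => g; rewrite in_inside in_setD1 in_setU1 in_inside.
  by case: (eqVneq g e) => [->|_ /= /andP[/andP[_ ->] ->]] //;
    rewrite (negbTE eX) andbF.
have [e'X|e'X] := boolP (ends e' \subset X).
  suff : inside ((e |: F) :\ e') X \subset e |: (inside F X :\ e').
    move/subset_leq_card; rewrite cardsU1 => le.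
    have := cardsD1 e' (inside F X); rewrite in_inside e'F e'X.
    case: (e \notin _) le; arith.
  apply/subsetP => g; rewrite in_inside in_setU1 !in_setD1 in_setU1 in_inside.
  by case: (g == e) => //= /andP[/andP[-> ->] ->].
have [xX yX] : x \in X /\ y \in X by apply/andP; rewrite -(ends_subset2 _ Ee).
suff ntX : ~~ tight F X.
  have := subset_leq_card sub; rewrite cardsU1; move: ntX; rewrite /tight.
  case: (e \notin _); arith.
apply/negP => tX.
have DX0 : D :&: X != set0 by apply/set0Pn; exists x; rewrite inE xD.
have := Dmin (D :&: X);
  rewrite !inE xD xX yD yX => /(_ isT isT (tightI sF tD tX DX0)).
apply/negP; rewrite -ltnNge; apply/proper_card; rewrite properE subsetIl /=.
apply: contra e'X => /(subset_trans e'sD); rewrite subsetI => /andP[]; by [].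
Qed.

(** Augmentation: rearranging inside [A] and inside [B] makes [x] and [y] unsaturated at the same
    time. Adding [e] then respects the degree bound, so by maximality of [F] it violates sparsity,
    and both ends of [e] lie in a tight set. The union of that set with [A] and [B] is the good
    set. *)
Lemma good_merge F A B e x y :
  0 < M -> bounded_sparse F -> (forall K, bounded_sparse K -> #|K| <= #|F|) ->
  good F A -> good F B -> A :&: B = set0 -> e \notin F -> ends e = [set x; y] ->
  x \in A -> y \in B -> exists D, [/\ good F D, A \subset D & B \subset D].
Proof.
move=> M_gt0 bF Fmax gA gB AB eF Ee xA yB.
have [sF dF] := bounded_sparseP _ bF.
have [A0 tA fA] := goodP _ _ gA; have [B0 tB fB] := goodP _ _ gB.
have xB : x \notin B by apply/negP => xB; have := in_set0 x; rewrite -AB inE xA xB.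
have yA : y \notin A by apply/negP => yA; have := in_set0 y; rewrite -AB inE yA yB.
have xy : x != y by apply: contra xB => /eqP->.
have eA : ~~ (ends e \subset A) by rewrite (ends_subset2 _ Ee) (negbTE yA) andbF.
have eB : ~~ (ends e \subset B) by rewrite (ends_subset2 _ Ee) (negbTE xB).
have nAB e1 : ends e1 \subset B -> (ends e1 \subset A) = false.
  move=> e1B; apply/negP => e1A; case/negP: (ends_neq0 e1).
  by rewrite -subset0 -AB subsetI e1A.
have [F1 mF1 dF1x] := fA x xA; have [F2 mF2 dF2y] := fB y yB.
have /and3P[bF1 /eqP cF1 ag1] := mF1; have /and3P[bF2 /eqP cF2 ag2] := mF2.
have [sF1 dF1] := bounded_sparseP _ bF1; have [sF2 dF2] := bounded_sparseP _ bF2.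
pose F' : factor G := [set e1 | if ends e1 \subset A then e1 \in F1 else
                     if ends e1 \subset B then e1 \in F2 else e1 \in F].
have inF' e1 : (e1 \in F') = if ends e1 \subset A then e1 \in F1 else
                     if ends e1 \subset B then e1 \in F2 else e1 \in F by rewrite inE.
clearbody F'.
have ag' : agree_outside B F1 F'.
  apply/agree_outsideP => e1 e1B; rewrite inF' (negbTE e1B).
  by case: (boolP (ends e1 \subset A)) => // /(agree_outsideP _ _ _ ag1) ->.
have F1B X : X \subset B -> inside F1 X = inside F X.
  move=> XB; apply/setP => e1; rewrite !in_inside.
  case: (boolP (ends e1 \subset X)); rewrite ?andbF //= => e1X; rewrite !andbT.
  by apply: (agree_outsideP _ _ _ ag1); rewrite nAB // (subset_trans e1X).
have F'B X : X \subset B -> inside F' X = inside F2 X.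
  move=> XB; apply/setP => e1; rewrite !in_inside.
  case: (boolP (ends e1 \subset X)); rewrite ?andbF //= => e1X; rewrite !andbT.
  by rewrite inF' nAB (subset_trans e1X).
have F'A : inside F' A = inside F1 A.
  apply/setP => e1; rewrite !in_inside inF'.
  by case: (boolP (ends e1 \subset A)); rewrite ?andbF.
have tF1B : tight F1 B by rewrite /tight F1B.
have sF' : sparse M F'.
  apply: (sparse_replace sF1 tF1B ag') => X X0 XB; rewrite F'B //.
  exact: (sparseP _ _ sF2).
have cF'1 Y : B \subset Y -> #|inside F' Y| = #|inside F1 Y|.
  by move=> BY; apply: card_inside_agree ag' _ BY; rewrite F'B // F1B.
have cF'F Y : A \subset Y -> B \subset Y -> #|inside F' Y| = #|inside F Y|.
  by move=> AY BY; rewrite cF'1 //; apply: card_inside_agree ag1 cF1 AY.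
have dF'A v : v \in A -> degree F' v = degree F1 v.
  move=> vA; apply: eq_degree => e1 ve1; rewrite inF'.
  case: (boolP (ends e1 \subset A)) => // e1A.
  rewrite (agree_outsideP _ _ _ ag1) //;
    case: (boolP (_ \subset B)) => // /subsetP/(_ v ve1).
  by move=> vB; have := in_set0 v; rewrite -AB inE vA vB.
have dF'B v : v \in B -> degree F' v = degree F2 v.
  move=> vB; apply: eq_degree => e1 ve1; rewrite inF'.
  case: (boolP (ends e1 \subset A)) => [/subsetP/(_ v ve1)|e1A].
    by move=> vA; have := in_set0 v; rewrite -AB inE vA vB.
  by case: (boolP (ends e1 \subset B)) => // /(agree_outsideP _ _ _ ag2) ->.
have dF' v : degree F' v <= h.
  have [/dF'A->//|vA] := boolP (v \in A); have [/dF'B->//|vB] := boolP (v \in B).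
  rewrite (_ : degree F' v = degree F v) //; apply: eq_degree => e1 ve1;
    rewrite inF'.
  case: (boolP (ends e1 \subset A)) => [/subsetP/(_ v ve1)|_];
    first by rewrite (negbTE vA).
  by case: (boolP (ends e1 \subset B)) => [/subsetP/(_ v ve1)|//];
    rewrite (negbTE vB).
have eF' : e \notin F' by rewrite inF' (negbTE eA) (negbTE eB).
have cF' : #|F'| = #|F| by rewrite -(insideT F') -(insideT F) cF'F ?subsetT.
have dF'x : degree F' x < h by rewrite dF'A.
have dF'y : degree F' y < h by rewrite dF'B.
have dF3 v : degree (e |: F') v <= h.
  apply: leq_trans (degree_setU1 _ _ _) _; rewrite Ee !inE.
  case: (eqVneq v x) => [->|_] /=; first by rewrite addn1.
  by case: (eqVneq v y) => [->|_] /=; rewrite ?addn1 ?addn0.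
have nsF3 : ~~ sparse M (e |: F').
  apply/negP => sF3; have : bounded_sparse (e |: F') by apply/bounded_sparseP.
  by move/Fmax; rewrite cardsU1 eF' cF'; arith.
pose P X := [&& x \in X, y \in X & tight F' X].
have [X0 PX0] : exists X, P X.
  move: nsF3; rewrite negb_forall => /existsP[X];
    rewrite negb_imply => /andP[X0 nX].
  have cX := sparseP _ _ sF' X X0; exists X; rewrite /P andbA.
  have [eX|eX] := boolP (ends e \subset X); last first.
    case/negP: nX; rewrite (_ : inside _ X = inside F' X) //.
    apply/setP => e1; rewrite !in_inside in_setU1.
    by case: eqP => //= ->; rewrite (negbTE eX) andbF.
  rewrite -(ends_subset2 _ Ee) eX /= /tight.
  have : inside (e |: F') X \subset e |: inside F' X.
    apply/subsetP => e1; rewrite in_inside !in_setU1 in_inside.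
    by case: eqP => //= _ /andP[-> ->].
  move/subset_leq_card; rewrite cardsU1 => le.
  by move: nX; case: (e \notin _) le; arith.
have [D /and3P[xD yD tD] Dmin] := arg_minnP (fun X => #|X|) PX0.
have tF'A : tight F' A by rewrite /tight F'A cF1.
have tF'B : tight F' B by rewrite /tight F'B // cF2.
have tD' : tight F' (A :|: D :|: B).
  apply: tightU => //; last by apply/set0Pn; exists y; rewrite !inE yD yB orbT.
  by apply: tightU => //; apply/set0Pn; exists x; rewrite !inE xA xD.
have AD' : A \subset A :|: D :|: B by rewrite -setUA subsetUl.
have BD' : B \subset A :|: D :|: B by rewrite subsetUr.
have DD' : D \subset A :|: D :|: B by rewrite -setUA setUCA subsetUl.
exists (A :|: D :|: B); split=> //; apply/goodP; split.
- by apply/set0Pn; exists x; rewrite !inE xA.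
- by rewrite /tight -cF'F.
move=> v; have [vA _|vA] := boolP (v \in A).
  by have [K mK dK] := fA v vA; exists K => //; apply: modificationS mK.
have [vB _|vB] := boolP (v \in B).
  by have [K mK dK] := fB v vB; exists K => //; apply: modificationS mK.
rewrite !inE (negbTE vA) (negbTE vB) orbF /= => vD.
have D1 : 1 < #|D|.
  have <- : #|[set x; y]| = 2 by rewrite cards2 xy.
  by apply/subset_leq_card; rewrite subUset !sub1set xD.
(* Exchanging an edge [e'] at [v] for [e] lowers the degree of [v], which is not an end of [e],
   while [x] and [y] have room for [e]. *)
have [e' e'D ve'] := tight_edge M_gt0 sF' tD vD D1.
move: (e'D); rewrite in_inside => /andP[e'F' e'sD].
have ve : v \notin ends e.
  by rewrite Ee !inE; apply/norP; split;
    [apply: contra vA|apply: contra vB] => /eqP->.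
have ee' : e != e' by apply: contra ve => /eqP->.
exists ((e |: F') :\ e'); last first.
  apply: leq_trans (dF' v).
  rewrite [X in _ < X](_ : _ = (degree (F' :\ e') v).+1).
    rewrite ltnS; apply: eq_leq; apply: eq_degree => e1 ve1; rewrite !inE.
    by case: (eqVneq e1 e) => [E|//]; rewrite E (negbTE ve) in ve1.
  rewrite /degree (cardsD1 e') !inE e'F' ve'; congr _.+1; apply: eq_card => e1.
  by rewrite !inE andbA.
apply/and3P; split.
- apply/bounded_sparseP; split; last first.
    by move=> w; apply: leq_trans (dF3 w); apply/degreeS/subD1set.
  by apply: (tight_exchange sF' xD yD tD Ee) => // X xX yX tX; apply: Dmin;
    rewrite /P xX yX.
- rewrite -cF'F //; apply/eqP.
  have -> : inside ((e |: F') :\ e') (A :|: D :|: B) =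
            e |: (inside F' (A :|: D :|: B) :\ e').
    apply/setP => e1; rewrite in_inside in_setD1 !in_setU1 in_setD1 in_inside.
    case: (eqVneq e1 e) => [->|] //=; last by rewrite andbA.
    by rewrite ee' (ends_subset2 _ Ee) (subsetP DD' x) // (subsetP DD' y).
  rewrite cardsU1 !inE (negbTE eF') andbF /=.
  by rewrite [RHS](cardsD1 e') in_inside e'F' (subset_trans e'sD).
apply/agree_outsideP => e1 e1D'.
have e1e : e1 != e.
  by apply: contra e1D' => /eqP->; rewrite (ends_subset2 _ Ee) !inE xA yB orbT.
have e1e' : e1 != e' by apply: contra e1D' => /eqP->; apply: (subset_trans e'sD).
have e1A : ~~ (ends e1 \subset A) by apply: contra e1D' => /subset_trans; apply.
have e1B : ~~ (ends e1 \subset B) by apply: contra e1D' => /subset_trans; apply.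
by rewrite !in_setD1 in_setU1 (negbTE e1e) e1e' inF' (negbTE e1A) (negbTE e1B).
Qed.

End DegreeBound.

(** * Deleting few vertices from a tough graph *)

(** Counting by a relation spares the choice of an explicit injection where witnesses come from
    existential statements. *)
Lemma leq_card_rel (T1 T2 : finType) (A : {set T1}) (B : {set T2})
    (R : T1 -> T2 -> bool) :
  (forall x, x \in A -> exists2 y, y \in B & R x y) ->
  (forall x x' y, x \in A -> x' \in A -> y \in B -> R x y -> R x' y -> x = x') ->
  #|A| <= #|B|.
Proof.
move=> ex uniq; pose g y := [pick x in A | R x y].
rewrite -(card_imset A (@Some_inj _)).
apply: leq_trans (leq_imset_card g B);
  apply/subset_leq_card/subsetP => _ /imsetP[x xA ->].
have [y yB Rxy] := ex x xA; apply/imsetP; exists y => //; rewrite /g.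
case: pickP => [x' /andP[x'A Rx'y]|/(_ x)]; last by rewrite xA Rxy.
by rewrite (uniq x x' y).
Qed.

Lemma card_bigcup_disjoint (I T : finType) (A : {set I}) (B : I -> {set T}) :
  {in A &, forall i j, i != j -> [disjoint B i & B j]} ->
  #|\bigcup_(i in A) B i| = \sum_(i in A) #|B i|.
Proof.
move=> dB; pose B' i := if i \in A then B i else set0.
have -> : \bigcup_(i in A) B i = \bigcup_i B' i by rewrite big_mkcond.
rewrite -sum1_card partition_disjoint_bigcup => [|i j ij]; last first.
  rewrite /B'; case: ifP => iA; last by rewrite -setI_eq0 set0I.
  by case: ifP => jA; [exact: dB | rewrite -setI_eq0 setI0].
rewrite [RHS]big_mkcond; apply: eq_bigr => i _; rewrite sum1_card /B'.
by case: ifP; rewrite ?cards0.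
Qed.

(** Greedy choice: each selected element discards at most [d] elements, itself included. *)
Lemma exists_independent_set (T : finType) (r : rel T) (d : nat) (A : {set T}) :
  symmetric r ->
  (forall Q : {set T}, Q \subset A -> Q != set0 ->
     exists2 x, x \in Q & #|[set y in Q | (y != x) && r x y]| < d) ->
  exists I : {set T}, [/\ I \subset A, #|A| <= d * #|I|
     & {in I &, forall x y, x != y -> ~~ r x y}].
Proof.
move=> r_sym; have [n] := ubnP #|A|; elim: n A => // n IHn A ltA degen.
have [A0|A0] := eqVneq A set0.
  by exists set0; rewrite sub0set A0 cards0; split=> // x y; rewrite inE.
have [x xA xd] := degen A (subxx _) A0.
set N := [set y in A | _] in xd.
have sub : A :\ x :\: N \subset A by rewrite setDDl subsetDl.
case: (IHn (A :\ x :\: N)).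
- apply: leq_trans (_ : #|A :\ x|.+1 <= _); last first.
    by move: ltA; rewrite (cardsD1 x) xA.
  by rewrite ltnS subset_leq_card ?subsetDl.
- by move=> Q QA; apply: degen; apply: subset_trans sub.
move=> I [IA cI sepI]; exists (x |: I); split.
- by rewrite subUset sub1set xA (subset_trans IA).
- have xI : x \notin I by apply/negP => /(subsetP IA); rewrite !inE eqxx andbF.
  rewrite cardsU1 xI mulnDr muln1 (cardsD1 x A) xA.
  have := cardsID N (A :\ x); have := subset_leq_card (subsetIr (A :\ x) N).
  arith.
move=> y z; rewrite !in_setU1.
have nb w : w \in I -> ~~ r x w.
  by move/(subsetP IA); rewrite !inE => /and3P[+ wx wA]; rewrite wA wx.
move=> /orP[/eqP->|yI] /orP[/eqP->|zI]; rewrite ?eqxx // => yz.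
- exact: nb.
- by rewrite r_sym; apply: nb.
- exact: sepI.
Qed.

Section Toughness.

Variable G : multigraph.
Implicit Types (F K : factor G) (X S W C P Q : {set G}) (e : edge G) (x y u v : G).
Implicit Types (I : {set {set G}}).

Definition nat_tough (t : nat) : Prop :=
  forall S, 1 < omega [set: edge G] S -> t * omega [set: edge G] S <= #|S|.

Lemma tough_nat_tough (R : realType) (t : nat) : tough (t%:R : R)%R G ->
  nat_tough t.
Proof.
move=> [t0 H] S S1; have := H S.
rewrite le_max => /orP[|].
  by rewrite (ler_nat R _ 1) leqNgt S1.
by rewrite mulrC ler_pdivlMr // -natrM ler_nat mulnC.
Qed.

Lemma card_separated_le_omega F X C :
  (forall x, x \in C -> x \notin X) ->
  {in C &, forall x y, x != y -> ~~ connect (adj F X) x y} ->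
  #|C| <= omega F X.
Proof.
move=> CX sep; have sym := adj_connect_sym F X.
have inj : {in C &, injective (fingraph.root (adj F X))}.
  move=> x y xC yC /eqP; rewrite root_connect //; case: (eqVneq x y) => // xy.
  by move/negP: (sep x y xC yC xy).
rewrite -(card_in_imset inj); apply: subset_leq_card.
apply/subsetP => _ /imsetP[x xC ->]; rewrite !inE roots_root //=.
have cl : closed (adj F X) (~: X).
  by move=> y z /and3P[yX zX _]; rewrite !inE yX zX.
have := closed_connect cl (connect_root (adj F X) x).
by rewrite !inE => <-; apply: CX.
Qed.

Definition cut S I : {set G} :=
  S :|: [set y | (y \notin cover I) &&
                 [exists e, (y \in ends e) && ~~ [disjoint ends e & cover I]]].

Definition leaving S W : factor G :=
  [set e | [&& [disjoint ends e & S], ~~ [disjoint ends e & W] &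
    ~~ (ends e \subset W)]].

Lemma meetP (A B : {set G}) :
  reflect (exists2 x, x \in A & x \in B) (~~ [disjoint A & B]).
Proof.
rewrite -setI_eq0; apply: (iffP (set0Pn _)) => [[x]|[x xA xB]].
  by rewrite inE => /andP[xA xB]; exists x.
by exists x; rewrite inE xA.
Qed.

(** A vertex of the cut outside [S] is charged to an edge joining it to [cover I]; the other end
    lies in [cover I], so no edge is charged twice. *)
Lemma card_cut S I : [disjoint cover I & S] ->
  #|cut S I| <= #|S| + #|leaving S (cover I)|.
Proof.
move=> IS; rewrite -(cardsID S (cut S I)); apply: leq_add.
  by apply/subset_leq_card/subsetIr.
apply: (@leq_card_rel _ _ _ _ (fun y e => (y \in ends e) && (y \notin cover I))).
  move=> y; rewrite !inE => /andP[yS]; rewrite (negbTE yS) /=.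
  move=> /andP[yI /existsP[e /andP[ye eI]]].
  have [w we wI] := meetP _ _ eI; exists e; last by rewrite ye yI.
  rewrite inE eI /=; apply/andP; split; last by apply/subsetPn; exists y.
  have yw : y != w by apply: contra yI => /eqP->.
  rewrite (ends_eq ye we yw) -setI_eq0 -subset0; apply/subsetP => z.
  rewrite !inE => /andP[/orP[/eqP->|/eqP->] zS]; first by rewrite zS in yS.
  by move: IS; rewrite disjoint_subset => /subsetP/(_ w wI); rewrite inE zS.
move=> y y' e _ _ + /andP[ye yI] /andP[ye' yI'].
rewrite inE => /and3P[_ /meetP[w we wI] _]; apply/eqP/contraT => yy'.
have := we; rewrite (ends_eq ye ye' yy') !inE => /orP[]/eqP E.
  by rewrite E (negbTE yI) in wI.
by rewrite E (negbTE yI') in wI.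
Qed.

(* Each member of [I] is isolated by deleting [cut S I]. *)
Lemma card_le_omega_cut S I (Z : {set G}) :
  trivIset I -> set0 \notin I -> [disjoint cover I & S] ->
  (forall e P Q, P \in I -> Q \in I -> ~~ [disjoint ends e & P] ->
     ~~ [disjoint ends e & Q] -> P = Q) ->
  [disjoint Z & cover I :|: cut S I] -> #|Z| <= 1 ->
  #|I| + #|Z| <= omega [set: edge G] (cut S I).
Proof.
move=> tI I0 IS indep ZI Z1.
have pI : partition I (cover I) by rewrite /partition eqxx tI.
have trC := transversalP pI; set C := transversal I (cover I) in trC.
have Ccov x : x \in C -> x \in cover I by apply/subsetP/(transversal_sub trC).
have covcut x : x \in cover I -> x \notin cut S I.
  move=> xI; rewrite !inE xI orbF.
  by move: IS; rewrite disjoint_subset => /subsetP/(_ x xI); rewrite inE.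
have cl P : P \in I -> closed (adj [set: edge G] (cut S I)) P.
  move=> PI; apply: intro_closed; first exact: adj_connect_sym.
  move=> x y /and3P[xX yX /existsP[e /andP[_ /eqP Ee]]] xP.
  have xe : x \in ends e by rewrite Ee !inE eqxx.
  have ye : y \in ends e by rewrite Ee !inE eqxx orbT.
  have eP : ~~ [disjoint ends e & P] by apply/meetP; exists x.
  have : y \in cover I.
    apply: contraR yX => yI; rewrite !inE yI /=; apply/orP; right.
    apply/existsP; exists e; rewrite ye; apply/meetP; exists x => //.
    by apply/bigcupP; exists P.
  case/bigcupP => Q QI yQ; have eQ : ~~ [disjoint ends e & Q] by apply/meetP;
    exists y.
  by rewrite (indep e P Q).
have ZC x : x \in Z -> x \notin cover I /\ x \notin cut S I.
  move=> xZ; move: ZI; rewrite disjoint_subset => /subsetP/(_ x xZ).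
  by rewrite !inE negb_or => /andP[].
have sepCZ x y : x \in cover I -> y \in Z ->
  ~~ connect (adj [set: edge G] (cut S I)) x y.
  move=> xI /ZC[yI _]; apply/negP => /(closed_connect (cl _ (pblock_mem xI))).
  by rewrite mem_pblock xI => /esym yP; case/negP: yI; apply/bigcupP;
    exists (pblock I x);
     rewrite ?pblock_mem.
have dCZ : [disjoint C & Z].
  rewrite -setI_eq0 -subset0; apply/subsetP => x;
    rewrite inE => /andP[/Ccov xI /ZC[]].
  by rewrite xI.
rewrite -(card_transversal trC) -cardsUI (eqP _ : C :&: Z = set0); last first.
  by rewrite -setI_eq0 in dCZ.
rewrite cards0 addn0; apply: card_separated_le_omega.
  by move=> x; rewrite inE => /orP[/Ccov/covcut|/ZC[]].
move=> x y; rewrite !inE => /orP[xC|xZ] /orP[yC|yZ] xy.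
- apply/negP => /(closed_connect (cl _ (pblock_mem (Ccov x xC)))).
  rewrite mem_pblock (Ccov x xC) => /esym yP; case/eqP: xy.
  apply: (pblock_inj trC) => //.
  by rewrite (same_pblock tI yP).
- exact: sepCZ (Ccov x xC) yZ.
- by rewrite (adj_connect_sym _ _ x y); apply: sepCZ (Ccov y yC) xZ.
- by move: Z1; rewrite leqNgt => /negP; case; apply/card_gt1P; exists x, y.
Qed.

Lemma nat_tough_cut t S I : nat_tough t ->
  trivIset I -> set0 \notin I -> [disjoint cover I & S] ->
  (forall e P Q, P \in I -> Q \in I -> ~~ [disjoint ends e & P] ->
     ~~ [disjoint ends e & Q] -> P = Q) ->
  1 < #|I| -> t * #|I| <= #|S| + #|leaving S (cover I)|.
Proof.
move=> tG tI I0 IS indep cI; apply: leq_trans (card_cut IS).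
have := @card_le_omega_cut S I set0 tI I0 IS indep.
rewrite cards0 addn0 -setI_eq0 set0I eqxx => /(_ isT isT) le.
by apply: leq_trans (tG _ (leq_trans cI le)); rewrite leq_mul2l le orbT.
Qed.

(** Any vertex outside [P] and its cut provides a second component. If there is none, [P] and the
    cut exhaust the graph, and a lower bound on |V| takes over. *)
Lemma nat_tough_cut1 t S P : nat_tough t -> P != set0 -> [disjoint P & S] ->
  2 * t <= #|S| + #|leaving S P| \/ #|[set: G]| <= #|P| + #|S| + #|leaving S P|.
Proof.
move=> tG P0 PS; have cP : cover [set P] = P by rewrite /cover big_set1.
have cc := @card_cut S [set P]; rewrite cP in cc; move/(_ PS) in cc.
have [E|] := eqVneq (P :|: cut S [set P]) setT.
  right; rewrite -E -addnA; apply: leq_trans (leq_card_setU _ _) _.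
  by rewrite leq_add2l.
rewrite -subTset => /subsetPn[z _ zX]; left; apply: leq_trans cc.
have := @card_le_omega_cut S [set P] [set z].
rewrite cP !cards1 => /(_ _ _ PS _ _ isT) le.
have le2 : 1 < omega [set: edge G] (cut S [set P]).
  apply: le.
  - by apply/trivIsetP => A B; rewrite !inE => /eqP-> /eqP->; rewrite eqxx.
  - by rewrite inE eq_sym.
  - by move=> e A B; rewrite !inE => /eqP-> /eqP->.
  - by rewrite disjoints1.
by apply: leq_trans (tG _ le2); rewrite mulnC leq_mul2l le2 orbT.
Qed.

End Toughness.

(** * Sparse factors of small degree *)

Lemma card_sum_mem (T : finType) (A : {set T}) : #|A| = \sum_x (x \in A).
Proof. by rewrite -sum1_card big_mkcond; apply: eq_bigr => x _;
  case: (x \in A). Qed.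

Lemma double_counting (T1 T2 : finType) (A : {set T1}) (B : {set T2})
    (R : T1 -> T2 -> bool) :
  \sum_(x in A) #|[set y in B | R x y]| = \sum_(y in B) #|[set x in A | R x y]|.
Proof.
have E (T : finType) (C : {set T}) (r : pred T) :
  #|[set x in C | r x]| = \sum_(x in C) r x.
  rewrite card_sum_mem [RHS]big_mkcond; apply: eq_bigr => x _.
  by rewrite inE; case: (x \in C).
under eq_bigr do rewrite E.
under [RHS]eq_bigr do rewrite E.
exact: exchange_big.
Qed.

Section DegreeSums.

Variables (G : multigraph).
Implicit Types (F K : factor G) (X S W A P Q : {set G}) (e : edge G) (x y u v : G).
Implicit Types (I : {set {set G}}).

Lemma sum_degree F A : \sum_(v in A) degree F v = \sum_(e in F) #|ends e :&: A|.
Proof.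
rewrite /degree (double_counting A F (fun v e => v \in ends e)).
by apply: eq_bigr => e _; apply: eq_card => v; rewrite !inE andbC.
Qed.

Lemma sum_degreeT F : \sum_v degree F v = 2 * #|F|.
Proof.
have -> : \sum_v degree F v = \sum_(v in [set: G]) degree F v.
  by apply: eq_bigl => v; rewrite inE.
rewrite sum_degree (eq_bigr (fun _ => 2)); first by rewrite sum_nat_const mulnC.
by move=> e _; rewrite setIT ends_card.
Qed.

Definition crossing F I : factor G :=
  inside F (cover I) :\: \bigcup_(P in I) inside F P.

Lemma crossingP F I e :
  reflect [/\ e \in F, ends e \subset cover I
             & forall P, P \in I -> ~~ (ends e \subset P)]
          (e \in crossing F I).
Proof.
rewrite in_setD in_inside; apply: (iffP and3P) => -[].
  move=> nU eF eI; split=> // P PI; apply: contra nU => eP.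
  by apply/bigcupP; exists P; rewrite // in_inside eF.
move=> eF eI H; split=> //; apply/bigcupP => -[P PI].
by rewrite in_inside (negbTE (H P PI)) andbF.
Qed.

Lemma inside_disjoint F P Q : [disjoint P & Q] ->
  [disjoint inside F P & inside F Q].
Proof.
rewrite -!setI_eq0 => /eqP PQ; rewrite -subset0; apply/subsetP => e.
rewrite inE !in_inside => /andP[/andP[_ eP] /andP[_ eQ]].
by case/negP: (ends_neq0 e); rewrite -subset0 -PQ subsetI eP.
Qed.

Lemma sum_inside F I : trivIset I ->
  \sum_(P in I) #|inside F P| = #|\bigcup_(P in I) inside F P|.
Proof.
move=> /trivIsetP tI; rewrite card_bigcup_disjoint // => P Q PI QI PQ.
exact/inside_disjoint/tI.
Qed.

Lemma sum_tight M F I : (forall P, P \in I -> tight M F P) -> trivIset I ->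
  \sum_(P in I) #|inside F P| + M * #|I| = M * #|cover I|.
Proof.
move=> tI /eqP tr;
  have -> : M * #|I| = \sum_(P in I) M by rewrite sum_nat_const mulnC.
rewrite -tr big_distrr /= -big_split /=.
by apply: eq_bigr => P /tI/eqP.
Qed.

(** [cover I] spans at most M (|cover I| - 1) edges, of which the tight members already take M
    (|cover I| - |I|). *)
Lemma card_crossing M F I : sparse M F -> (forall P, P \in I -> tight M F P) ->
  trivIset I -> set0 \notin I -> I != set0 -> #|crossing F I| + M <= M * #|I|.
Proof.
move=> sF tiI trI I0 /set0Pn[P PI].
have sub : \bigcup_(Q in I) inside F Q \subset inside F (cover I).
  by apply/bigcupsP => Q QI; apply/inside_subset/bigcup_sup.
have := subset_leq_card sub.
have c0 : cover I != set0.
  have /set0Pn[x xP] : P != set0 by apply: contraNneq I0 => <-.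
  by apply/set0Pn; exists x; apply/bigcupP; exists P.
have := sparseP _ _ sF _ c0; have := sum_tight tiI trI.
by rewrite sum_inside // /crossing cardsD (setIidPr sub); arith.
Qed.

(** Edges inside the members miss [S]. At most M (|S| + |I| - 1) edges remain, and only those inside
    [S] are counted twice. *)
Lemma sum_degree_le M F S I : sparse M F -> (forall P, P \in I -> tight M F P) ->
  trivIset I -> S = ~: cover I -> 0 < #|[set: G]| ->
  \sum_(v in S) degree F v + M <= #|inside F S| + M * #|S| + M * #|I|.
Proof.
move=> sF tiI trI ES n0; rewrite sum_degree.
have V0 : [set: G] != set0 by rewrite -card_gt0.
have := sparseP _ _ sF _ V0; rewrite insideT.
have := sum_tight tiI trI; rewrite sum_inside //.
have := cardsC (cover I); rewrite -ES -cardsT => <-; rewrite mulnDr.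
set U := \bigcup_(P in I) _.
have UF : U \subset F by apply/bigcupsP => P _; apply/subsetP => e;
  rewrite in_inside => /andP[].
have SU : inside F S \subset F by apply/subsetP => e; rewrite in_inside => /andP[].
have := cardsID U F; rewrite (setIidPr UF).
suff : \sum_(e in F) #|ends e :&: S| <= #|F :\: U| + #|inside F S| by arith.
rewrite !card_sum_mem -big_split big_mkcond /=; apply: leq_sum => e _.
rewrite in_setD in_inside; case: (boolP (e \in F)) => //= eF.
rewrite andbT.
have [eU|eU] := boolP (e \in U).
  have /bigcupP[P PI] := eU; rewrite in_inside => /andP[_ eP].
  rewrite (_ : _ :&: S = set0) ?cards0 //.
  apply/eqP; rewrite setI_eq0 ES disjoints_subset setCK.
  exact: subset_trans eP (bigcup_sup _ PI).
have : #|ends e :&: S| <= 2 by rewrite -(ends_card e) subset_leq_card ?subsetIl.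
have [eS|eS] := boolP (ends e \subset S) => // _.
suff : #|ends e :&: S| < 2 by [].
by rewrite -(ends_card e); apply: proper_card;
  rewrite properE subsetIl subsetI subxx.
Qed.

End DegreeSums.

Lemma trivIset_eq (T : finType) (I : {set {set T}}) (A B : {set T}) x :
  trivIset I -> A \in I -> B \in I -> x \in A -> x \in B -> A = B.
Proof. by move=> tI AI BI xA xB;
  rewrite -(def_pblock tI AI xA) (def_pblock tI BI xB). Qed.

Section LowDegree.

Variables (G : multigraph).
Implicit Types (F K : factor G) (X S W A P Q : {set G}) (e : edge G) (x y u v : G).
Implicit Types (I J : {set {set G}}).

Definition meets e P : bool := ~~ [disjoint ends e & P].

Lemma meetsP e P : reflect (exists2 x, x \in ends e & x \in P) (meets e P).
Proof. exact: meetP. Qed.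

Definition linked : rel {set G} := fun P Q => [exists e, meets e P && meets e Q].

Lemma linked_sym : symmetric linked.
Proof. by move=> P Q; apply: eq_existsb => e; rewrite andbC. Qed.

Lemma meets2_ends I e P Q : trivIset I -> P \in I -> Q \in I -> P != Q ->
  meets e P -> meets e Q ->
    exists x y, [/\ x \in P, y \in Q, x != y & ends e = [set x; y]].
Proof.
move=> tI PI QI PQ /meetsP[x xe xP] /meetsP[y ye yQ].
have xy : x != y.
  by apply: contra PQ => /eqP E; apply/eqP; apply: (trivIset_eq tI PI QI xP);
    rewrite E.
by exists x, y; split=> //; apply: ends_eq.
Qed.

Lemma meets_card I e : trivIset I -> #|[set P in I | meets e P]| <= 2.
Proof.
move=> tI; rewrite -(ends_card e);
  apply: (@leq_card_rel _ _ _ _ (fun P x => x \in P)).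
  by move=> P; rewrite inE => /andP[_ /meetsP[x xe xP]]; exists x.
move=> P Q x; rewrite !inE => /andP[PI _] /andP[QI _] _.
exact: trivIset_eq tI PI QI.
Qed.

(** Averaging: fewer than M |I| edges of [F] join distinct members, and each meets at most two. As
    [F] contains every edge of the graph between members, this controls linking in the graph
    itself. *)
Lemma degenerate_linked M F I : 0 < M -> sparse M F ->
  (forall P, P \in I -> tight M F P) -> trivIset I -> set0 \notin I ->
  (forall e P Q, P \in I -> Q \in I -> P != Q -> meets e P -> meets e Q ->
    e \in F) ->
  I != set0 ->
  exists2 P, P \in I & #|[set Q in I | (Q != P) && linked P Q]| < 2 * M.
Proof.
move=> M0 sF tiI tI I0 crF In0; apply/exists_inP/contraT.
rewrite negb_exists_in => /forall_inP H.
have cC := card_crossing sF tiI tI I0 In0.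
suff : #|I| * (2 * M) <= #|crossing F I| * 2 by arith.
rewrite -!sum_nat_const.
apply: leq_trans (_ : \sum_(P in I) #|[set e in crossing F I | meets e P]| <= _).
  apply: leq_sum => P PI; have := H P PI; rewrite -leqNgt => /leq_trans; apply.
  apply: (@leq_card_rel _ _ _ _ (fun Q e => meets e Q)).
    move=> Q; rewrite inE => /and3P[QI QP /existsP[e /andP[eP eQ]]].
    exists e => //; rewrite inE eP andbT.
    rewrite eq_sym in QP.
    have [x [y [xP yQ xy Ee]]] := meets2_ends tI PI QI QP eP eQ.
    apply/crossingP; split; first exact: (crF e P Q).
      rewrite (ends_subset2 _ Ee); apply/andP.
      by split; apply/bigcupP; [exists P | exists Q].
    move=> W WI; apply/negP; rewrite (ends_subset2 _ Ee) => /andP[xW yW].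
    by case/eqP: QP;
      rewrite (trivIset_eq tI PI WI xP xW) (trivIset_eq tI QI WI yQ yW).
  move=> Q Q' e;
    rewrite !inE => /and3P[QI QP _] /and3P[Q'I Q'P _] /andP[_ eP] eQ eQ'.
  rewrite eq_sym in QP; have [x [y [xP yQ xy Ee]]] := meets2_ends tI PI QI QP eP eQ.
  case/meetsP: eQ' => z; rewrite Ee !inE => /orP[/eqP->|/eqP->] zQ'.
    by rewrite (trivIset_eq tI Q'I PI zQ' xP) eqxx in Q'P.
  exact: trivIset_eq tI QI Q'I yQ zQ'.
rewrite (double_counting I (crossing F I) (fun P e => meets e P)).
by apply: leq_sum => e _; apply: meets_card.
Qed.

(** Unlinked members fall into different components after a cut, which is what toughness counts;
    passing to them costs a factor 2 M. *)
Lemma exists_unlinked_parts M F I : 0 < M -> sparse M F ->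
  (forall P, P \in I -> tight M F P) -> trivIset I -> set0 \notin I ->
  (forall e P Q, P \in I -> Q \in I -> P != Q -> meets e P -> meets e Q ->
    e \in F) ->
  exists J, [/\ J \subset I, #|I| <= 2 * M * #|J|
    & {in J &, forall P Q, P != Q -> ~~ linked P Q}].
Proof.
move=> M0 sF tiI tI I0 crF; apply: (exists_independent_set linked_sym) => J JI J0.
apply: (degenerate_linked M0 sF _ _ _ _ J0).
- by move=> P /(subsetP JI); apply: tiI.
- exact: trivIsetS tI.
- by apply: contra I0; apply: (subsetP JI).
- by move=> e P Q /(subsetP JI) PI /(subsetP JI) QI; apply: crF.
Qed.

Lemma leaving_sub_crossing F I J : trivIset I ->
  (forall e P Q, P \in I -> Q \in I -> P != Q -> meets e P -> meets e Q ->
    e \in F) ->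
  J \subset I -> leaving (~: cover I) (cover J) \subset crossing F I.
Proof.
move=> tI crF JI; apply/subsetP => e; rewrite inE => /and3P[eS eJ enJ].
have eI : ends e \subset cover I by rewrite -[cover I]setCK -disjoints_subset.
have [x xe /bigcupP[P PJ xP]] := meetP _ _ eJ; have PI := subsetP JI P PJ.
have [y ye yJ] := subsetPn enJ.
have /bigcupP[Q QI yQ] := subsetP eI y ye.
have xy : x != y by apply: contra yJ => /eqP<-; apply/bigcupP; exists P.
have PQ : P != Q by apply: contra yJ => /eqP E; apply/bigcupP; exists P => //;
  rewrite E.
apply/crossingP; split=> //.
  by apply: (crF e P Q) => //; apply/meetsP; [exists x | exists y].
move=> W WI; apply/negP => /subsetP eW; case/eqP: PQ.
by rewrite (trivIset_eq tI PI WI xP (eW x xe)) (trivIset_eq tI QI WI yQ (eW y ye)).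
Qed.

Theorem tough_bounded_sparse M t : 0 < M -> nat_tough G t ->
  4 * M ^ 2 < t -> 8 * M ^ 2 < #|[set: G]| ->
  exists F, [/\ sparse M F, #|F| + M = M * #|[set: G]|
              & forall v, degree F v <= 2 * M + 1].
Proof.
move=> M0 tG t_gt n_gt; pose h := 2 * M + 1.
have b0 : bounded_sparse M h (set0 : factor G).
  apply/bounded_sparseP; split=> [|v].
    apply/sparseP => X X0; rewrite (_ : inside _ X = set0).
      by rewrite cards0 leq_pmulr // card_gt0.
    by apply/setP => e; rewrite in_inside !inE.
  rewrite (_ : degree _ v = 0) //; apply/eqP; rewrite cards_eq0;
    apply/eqP/setP => e.
  by rewrite !inE.
have [F bF Fmax] := arg_maxnP (fun F : factor G => #|F|) b0.
have [sF dF] := bounded_sparseP _ _ _ bF.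
suff tT : tight M F setT.
  by exists F; split=> //; rewrite -(eqP tT) insideT.
pose I := [set W | maxset (good M h F) W]; pose S := ~: cover I.
have gI P : P \in I -> good M h F P by rewrite inE => /maxsetp.
have maxI P W : P \in I -> good M h F W -> P \subset W -> W = P.
  by rewrite inE => mP gW PW; apply: maxsetsup mP gW PW.
have tiI P : P \in I -> tight M F P by move=> /gI/goodP[].
have I0 : set0 \notin I by apply/negP => /gI/goodP[]; rewrite eqxx.
have tI : trivIset I.
  apply/trivIsetP => P Q PI QI; apply: contraR; rewrite -setI_eq0 => PQ.
  have gPQ := goodU sF (gI P PI) (gI Q QI) PQ.
  by rewrite -(maxI _ _ PI gPQ (subsetUl _ _)) {1}(maxI _ _ QI gPQ (subsetUr _ _)).
have dS v : v \in S -> degree F v = h.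
  rewrite inE => vI; apply/eqP; rewrite eqn_leq dF leqNgt /=;
    apply: contra vI => dv.
  have [W mW vW] := maxset_exists (good_set1 bF dv).
  by apply/bigcupP; exists W; [rewrite inE | rewrite -sub1set].
have crF e P Q : P \in I -> Q \in I -> P != Q -> meets e P -> meets e Q -> e \in F.
  move=> PI QI PQ eP eQ;
    have [x [y [xP yQ xy Ee]]] := meets2_ends tI PI QI PQ eP eQ.
  apply/negPn/negP => eF.
  have PQ0 : P :&: Q = set0 by apply/eqP; rewrite setI_eq0; apply: (trivIsetP tI).
  have [D [gD PD QD]] := good_merge M0 bF Fmax (gI P PI) (gI Q QI) PQ0 eF Ee xP yQ.
  by case/eqP: PQ; rewrite -(maxI _ _ PI gD PD) -(maxI _ _ QI gD QD).
have n0 : 0 < #|[set: G]| by arith.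
have ndeg := sum_degree_le sF tiI tI (erefl S) n0.
rewrite (eq_bigr (fun _ => h)) // sum_nat_const /h in ndeg.
(* With at most one maximal good set the degree count empties [S], so that set is the whole vertex
   set and is tight. *)
have [I1|I2] := leqP #|I| 1.
  have S0 : S = set0.
    apply/eqP/contraT => S0; have := sparseP _ _ sF S S0.
    move: ndeg; have : 0 < #|S| by rewrite card_gt0.
    have : M * #|I| <= M by rewrite -[X in _ <= X]muln1 leq_mul2l I1 orbT.
    by arith.
  have cT : cover I = setT by rewrite -[LHS]setCK -/S S0 setC0.
  have [P PI] : exists P, P \in I.
    apply/set0Pn/eqP => IE; move: n0; rewrite -cT IE /cover big_set0 cards0.
    by [].
  suff <- : P = setT by apply: tiI.
  rewrite -cT; apply/eqP; rewrite eqEsubset (bigcup_sup P) //=.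
  apply/bigcupsP => Q QI; suff -> : Q = P by [].
  by apply/eqP/contraT => QP; move: I1; rewrite leqNgt => /negP; case;
    apply/card_gt1P; exists Q, P.
(* The choice h = 2 M + 1 enters here: the degree sum h |S| exceeds by |S| the term 2 M |S| obtained
   from sparsity. *)
have cSI : #|S| + 2 * M <= M * #|I|.
  have [S0|S0] := eqVneq S set0.
    by rewrite S0 cards0 add0n mulnC leq_mul2l I2 orbT.
  have := sparseP _ _ sF S S0; move: ndeg; arith.
have In0 : I != set0 by rewrite -card_gt0; apply: leq_trans I2.
have cC := card_crossing sF tiI tI I0 In0.
have [J [JI cJ sepJ]] := exists_unlinked_parts M0 sF tiI tI I0 crF.
have lvJ (K : {set {set G}}) : K \subset I ->
  #|leaving S (cover K)| + M <= M * #|I|.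
  move=> KI; apply: leq_trans cC; rewrite leq_add2r.
  exact/subset_leq_card/leaving_sub_crossing.
have covS (K : {set {set G}}) : K \subset I -> [disjoint cover K & S].
  by move=> KI; rewrite disjoints_subset setCK; apply/bigcupsP => P PK;
    apply/bigcup_sup/(subsetP KI).
(* Two or more unlinked members give t |J| <= |S| + |leaving| < 2 M |I| <= 4 M^2 |J|. *)
exfalso; have [J1|J2] := leqP #|J| 1; last first.
  have J0 : set0 \notin J by apply: contra I0; apply: (subsetP JI).
  have := nat_tough_cut tG (trivIsetS JI tI) J0 (covS J JI).
  have indep e P Q : P \in J -> Q \in J -> ~~ [disjoint ends e & P] ->
     ~~ [disjoint ends e & Q] -> P = Q.
    move=> PJ QJ eP eQ; apply/eqP/contraT => PQ; case/negP: (sepJ P Q PJ QJ PQ).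
    by apply/existsP; exists e; rewrite /meets eP.
  move=> /(_ indep J2); have := lvJ J JI; move: cJ cSI t_gt I2 M0.
  move: #|J| #|I| #|S| #|leaving _ _| => j i s l.
  clear; nia.
have cI : #|I| <= 2 * M by apply: (leq_trans cJ);
  rewrite -[X in _ <= X]muln1 leq_mul2l J1 orbT.
have [P0 P0I] := set0Pn _ In0.
(* A smallest of at least two disjoint sets has at most half of the vertices, so even if [A] and its
   cut exhaust the graph, |V| is at most 8 M^2. *)
have [A AI Amin] := arg_minnP (fun P : {set G} => #|P|) P0I.
have [B BI BA] : exists2 B, B \in I & B != A.
  have /card_gt1P[P [Q [PI QI PQ]]] := I2.
  have [E|] := eqVneq P A; last by exists P.
  by exists Q => //; rewrite -E eq_sym.
have An0 : A != set0 by apply: contraNneq I0 => <-.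
have covA : cover [set A] = A by rewrite /cover big_set1.
have sA : [set A] \subset I by rewrite sub1set.
have AS : [disjoint A & S] by have := covS _ sA; rewrite covA.
have lA := lvJ _ sA; rewrite covA in lA.
have c2 : 2 * #|A| <= #|[set: G]|.
  have AB0 : A :&: B = set0.
    by apply/eqP; rewrite setI_eq0; apply: (trivIsetP tI); rewrite // eq_sym.
  have : #|A :|: B| <= #|[set: G]| by apply: subset_leq_card.
  have := cardsUI A B; rewrite AB0 cards0; have := Amin B BI; arith.
have bnd : M * #|I| <= 2 * M ^ 2 by rewrite expnS expn1 mulnCA leq_mul2l cI orbT.
have := nat_tough_cut1 tG An0 AS; case=> ?; arith.
Qed.

End LowDegree.

(** * Factors with prescribed degrees *)

Section Gadget.

Variables (G : multigraph) (E : factor G) (f : G -> nat).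
Implicit Types (F K : factor G) (X S T U P Q : {set G}) (e : edge G) (u v w : G).

Lemma inside_set0 F : inside F set0 = set0.
Proof.
apply/setP => e; rewrite in_inside subset0 inE; apply/negbTE.
by rewrite negb_and ends_neq0 orbT.
Qed.

Lemma adj_ends F u w : adj F set0 u w = [exists e in F, ends e == [set u; w]].
Proof. by rewrite /adj !inE. Qed.

Lemma adj_closed F U : (forall e, e \in F -> ends e \subset U) ->
  closed (adj F set0) U.
Proof.
move=> FU u w; rewrite adj_ends => /exists_inP[e /FU eU /eqP Ee].
by move: eU; rewrite Ee subUset !sub1set => /andP[-> ->].
Qed.

(** The component of each member of [O] has fewer edges than vertices, and the rest of [U] has no
    more edges than vertices. *)
Lemma forest_separated K U (O : {set G}) : sparse 1 K ->
  (forall e, e \in K -> ends e \subset U) -> O \subset U ->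
  {in O &, forall x y, x != y -> ~~ connect (adj K set0) x y} ->
  #|O| + #|K| <= #|U|.
Proof.
move=> /sparseP sK KU OU sep; pose Q o := [set w | connect (adj K set0) o w].
have sym := adj_connect_sym K set0.
have Qo o : o \in Q o by rewrite inE connect0.
have QU o : o \in O -> Q o \subset U.
  move=> oO; apply/subsetP => w;
    rewrite inE => /(closed_connect (adj_closed KU)) <-.
  exact: (subsetP OU).
have dQ : {in O &, forall o o', o != o' -> [disjoint Q o & Q o']}.
  move=> o o' oO o'O oo'; rewrite -setI_eq0 -subset0; apply/subsetP => w.
  rewrite !inE => /andP[ow o'w]; case/negP: (sep o o' oO o'O oo').
  by apply: connect_trans ow _; rewrite sym.
have cQ := card_bigcup_disjoint dQ; set cov := \bigcup_(o in O) Q o in cQ.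
have covU : cov \subset U by apply/bigcupsP.
have c1 : \sum_(o in O) #|inside K (Q o)| + #|O| <= #|cov|.
  rewrite cQ -sum1_card -big_split /=; apply: leq_sum => o oO.
  rewrite -[#|Q o|]mul1n; apply: sK; by apply/set0Pn; exists o.
have c2 : #|inside K (U :\: cov)| <= #|U :\: cov|.
  have [->|/sK] := eqVneq (U :\: cov) set0; first by rewrite inside_set0 !cards0.
  by arith.
have : #|K| <= \sum_(o in O) #|inside K (Q o)| + #|inside K (U :\: cov)|.
  rewrite -card_bigcup_disjoint => [|o o' oO o'O oo']; last first.
    exact/inside_disjoint/dQ.
  apply: leq_trans (leq_card_setU _ _); apply/subset_leq_card/subsetP => e eK.
  rewrite in_setU in_inside eK /=; have [u [w [Ee uw]]] := ends_set2 e.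
  have Kuw : connect (adj K set0) u w.
    by apply: connect1; rewrite adj_ends; apply/exists_inP; exists e; rewrite ?Ee.
  have same o : (u \in Q o) = (w \in Q o) by rewrite !inE; apply: same_connect_r.
  have := KU e eK; rewrite !(ends_subset2 _ Ee) !inE => /andP[-> ->];
    rewrite !andbT.
  have [/bigcupP[o oO uo]|ucov] := boolP (u \in cov).
    apply/orP; left; apply/bigcupP; exists o => //;
      rewrite in_inside eK (ends_subset2 _ Ee).
    by rewrite -same uo.
  apply/orP; right => /=; apply: contra ucov => /bigcupP[o oO wo].
  by apply/bigcupP; exists o; rewrite // same.
have := cardsID cov U; rewrite (setIidPr covU); arith.
Qed.

(* Each vertex [v] is replaced by [f v] copies, and each edge by its two
   halves, which are adjacent to each other and to the copies of their
   respective ends; an edge is selected when its halves are matched to copies. *)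
Definition gadget : finType := ({v : G & 'I_(f v)} + edge G * G)%type.

Definition gadget_adj : rel gadget := fun x y : gadget =>
  match x, y with
  | inl c, inr h => tag c == h.2
  | inr h, inl c => tag c == h.2
  | inr h, inr h' => (h.1 == h'.1) && (h.2 != h'.2)
  | _, _ => false
  end.

Definition gadget_vertices : {set gadget} :=
  [set x : gadget | match x with inl _ => true | inr h => (h.1 \in E) && (h.2 \in ends h.1) end].

Definition avoiding F S : factor G := [set e in F | [disjoint ends e & S]].

Lemma gadget_adj_sym : symmetric gadget_adj.
Proof. by move=> [c|h] [c'|h'] //=; congr (_ && ~~ _); apply: eq_sym. Qed.

Lemma card_gadget_set (B : {set gadget}) :
  #|B| = #|[set c | inl c \in B]| + #|[set h | inr h \in B]|.
Proof.
rewrite !card_sum_mem big_sumType /=; congr (_ + _); apply: eq_bigr => z _;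
  by rewrite inE.
Qed.

Lemma card_copies S : #|[set c : {v :
  G & 'I_(f v)} | tag c \in S]| = \sum_(v in S) f v.
Proof.
rewrite card_sum_mem; under eq_bigr do rewrite inE.
rewrite -(@sig_big_dep nat 0 addn G (fun v => 'I_(f v)) xpredT (fun=> xpredT)
  (fun v _ => (v \in S) : nat)) /=.
rewrite [RHS]big_mkcond; apply: eq_bigr => v _.
by rewrite sum_nat_const card_ord; case: (v \in S); rewrite ?muln1 ?muln0.
Qed.

Lemma card_halves F S :
  #|[set h : edge G * G | [&& h.2 \in S, h.1 \in F & h.2 \in ends h.1]]| =
  \sum_(v in S) degree F v.
Proof.
rewrite card_sum_mem; under eq_bigr do rewrite inE.
rewrite -(pair_bigA _ (fun e v => [&& v \in S, e \in F & v \in ends e] : nat)) /=.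
rewrite exchange_big [RHS]big_mkcond; apply: eq_bigr => v _ /=.
rewrite /degree card_sum_mem; case: (v \in S) => /=; last by rewrite big1.
by apply: eq_bigr => e _; rewrite inE.
Qed.

(** If one half of an edge is matched to a copy, so is the other, whose remaining neighbours are
    copies. Hence the selected edges at [v] correspond to the copies of [v]. *)
Lemma factor_of_matching s : matching gadget_adj gadget_vertices s ->
  unmatched gadget_vertices s = set0 ->
  exists J : factor G, J \subset E /\ forall v, degree J v = f v.
Proof.
move=> /matchingP[sK sA] un0.
have sx (x : gadget) : x \in gadget_vertices ->
    s x != x /\ gadget_adj x (s x) /\ s x \in gadget_vertices.
  move=> xA; have : s x != x.
    by apply/negP => sx; have := in_set0 x; rewrite -un0 inE xA sx.
  move=> sx; have [_ ?] := sA x sx; split=> //; split=> //.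
  by have [] := sA (s x); rewrite ?sK // eq_sym.
pose J := [set e in E | [exists v in ends e, [exists c, s (inr (e, v)) == inl c]]].
exists J; split; first by apply/subsetP => e; rewrite inE => /andP[].
move=> v; rewrite -[RHS]card_ord -cardsT.
pose R e (i : 'I_(f v)) := s (inl (Tagged (fun v => 'I_(f v)) i)) == inr (e, v).
apply/eqP; rewrite eqn_leq; apply/andP; split.
  apply: (@leq_card_rel _ _ _ _ R) => [e|e e' i _ _ _]; last first.
    by rewrite /R => /eqP-> /eqP[].
  rewrite !inE => /andP[/andP[eE /exists_inP[u ue /existsP[c /eqP suc]]] ve].
  have [c' sc'] : exists c', s (inr (e, v)) = inl c'.
    have [uv|uv] := eqVneq u v; first by exists c; rewrite -uv.
    have vA : inr (e, v) \in gadget_vertices by rewrite inE eE.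
    have [_ [adjv]] := sx _ vA; case E1: (s (inr (e, v))) adjv => [c'|[e' w]];
      first by exists c'.
    rewrite /= => /andP[/eqP ee' vw]; subst e'; rewrite inE /= => /andP[_ we].
    have : w = u.
      by move: we; rewrite (ends_eq ue ve uv) !inE => /orP[]/eqP // wv;
        rewrite wv eqxx in vw.
    by move=> wu; move: suc; rewrite -wu -E1 sK.
  have vA : inr (e, v) \in gadget_vertices by rewrite inE eE.
  have [_ [+ _]] := sx _ vA; rewrite sc' /= => /eqP tv.
  case: c' => w i /= in sc' tv *; subst w.
  by exists i; rewrite // /R -[X in s X]sc' sK.
apply: (@leq_card_rel _ _ _ _ (fun i e => R e i)) => [i _|i i' e _ _ _]; last first.
  by rewrite /R => /eqP <- /eqP /(can_inj sK) [] /eqP; rewrite eq_Tagged => /eqP.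
pose x : gadget := inl (Tagged (fun v => 'I_(f v)) i).
have xA : x \in gadget_vertices by rewrite inE.
have [_ [adjx]] := sx x xA; case E1: (s x) adjx => [//|[e w]] /= /eqP vw.
subst w; rewrite inE /= => /andP[eE ve]; exists e; last by rewrite /R -/x E1.
rewrite !inE eE ve andbT; apply/exists_inP; exists v => //; apply/existsP.
by exists (Tagged (fun v => 'I_(f v)) i); rewrite -E1 sK.
Qed.


Lemma odd_gadget : odd #|gadget_vertices| = odd (\sum_v f v).
Proof.
rewrite card_gadget_set.
have -> : #|[set c | inl c \in gadget_vertices]| = \sum_v f v.
  have -> : \sum_v f v = \sum_(v in [set: G]) f v by apply: eq_bigl => v;
    rewrite inE.
  by rewrite -card_copies; apply: eq_card => c; rewrite !inE.
have -> : #|[set h | inr h \in gadget_vertices]| = 2 * #|E|.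
  rewrite -sum_degreeT.
  have -> : \sum_v degree E v = \sum_(v in [set: G]) degree E v.
    by apply: eq_bigl => v; rewrite inE.
  by rewrite -card_halves; apply: eq_card => h; rewrite !inE.
by rewrite oddD oddM addbF.
Qed.

(* The barrier [Z] of [gadget_adj] defines [S] (all copies deleted) and [T]
   (all half-edges deleted). Every unmatched vertex [x] of the gadget is a copy
   of a vertex of [T], or is a half-edge whose other half is deleted and lies at
   [S], or can be charged to a vertex [owner x] of the rest [U]; owners of
   distinct vertices are separated in the part [K] of the tree [T0] that
   survives. *)
Section Barrier.

Variables (T0 : factor G) (Z : {set gadget}) (s : {ffun gadget -> gadget}).
Hypotheses (T0_sparse : sparse 1 T0) (T0_card : #|T0| + 1 = #|[set: G]|).
Hypothesis T0E : T0 \subset E.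
Let A' := gadget_vertices :\: Z.
Hypothesis s_matching : matching gadget_adj A' s.
Hypothesis s_separated : {in unmatched A' s &, forall x y,
  x != y -> ~~ connect (restrict gadget_adj A') x y}.

Let S := [set v : G | [forall c, (tag c == v) ==> (inl c \in Z)]].
Let T := [set v in ~: S |
  [forall e, (e \in E) && (v \in ends e) ==> (inr (e, v) \in Z)]].
Let U := ~: (S :|: T).
Let K := [set e in T0 | (ends e \subset U) && [forall v in ends e, inr (e,
  v) \notin Z]].
(** Deleted halves whose opposite end lies in [S]; they pay for the members of [C2]. *)
Let Y := [set h : edge G * G | (inr h \in Z) &&
            [exists w in ends h.1, (w != h.2) && (w \in S)]].
Let C := unmatched A' s.
Let C1 := [set x in C | if x is inl c then tag c \in T else false].
Let C2 := [set x in C | if x is inr h then (h.2 \in S) &&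
            [exists w in ends h.1, (w != h.2) && (inr (h.1, w) \in Z)] else false].
Let C3 := C :\: (C1 :|: C2).

Let joined : rel gadget := connect (restrict gadget_adj A').

Lemma joined_sym : symmetric joined.
Proof.
apply: sym_connect_sym => x y.
by rewrite /restrict gadget_adj_sym andbCA.
Qed.

Lemma joined1 x y : x \in A' -> y \in A' -> gadget_adj x y -> joined x y.
Proof. by move=> xA yA xy; apply: connect1; rewrite /restrict xA yA. Qed.

Lemma copy_in c : inl c \notin Z -> inl c \in A'.
Proof. by move=> cZ; rewrite in_setD cZ inE. Qed.

Lemma half_in e v : e \in E -> v \in ends e -> inr (e, v) \notin Z ->
  inr (e, v) \in A'.
Proof. by move=> eE ve hZ; rewrite in_setD hZ inE eE. Qed.

Lemma half_out e v : inr (e, v) \in A' ->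
  [/\ e \in E, v \in ends e & inr (e, v) \notin Z].
Proof. by rewrite in_setD inE => /and3P[]. Qed.

Lemma disjoint_ST : S :&: T = set0.
Proof.
by apply/setP => v; rewrite in_setI [v \in T]inE in_setC in_set0; case: (v \in S).
Qed.

Lemma in_U v : (v \in U) = (v \notin S) && (v \notin T).
Proof. by rewrite in_setC in_setU negb_or. Qed.

Lemma copy_S c : inl c \notin Z -> tag c \notin S.
Proof.
move=> cZ; apply/negP; rewrite inE => /forallP/(_ c).
by rewrite eqxx (negbTE cZ).
Qed.

Lemma half_T e v : inr (e, v) \in A' -> v \notin T.
Proof.
case/half_out => eE ve hZ; apply/negP; rewrite inE => /andP[_ /forallP/(_ e)].
by rewrite eE ve (negbTE hZ).
Qed.

Lemma U_copy v : v \in U -> exists2 c, tag c = v & inl c \notin Z.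
Proof.
rewrite in_U => /andP[+ _]; rewrite inE negb_forall => /existsP[c].
by rewrite negb_imply => /andP[/eqP cv cZ]; exists c.
Qed.

Lemma U_half v : v \in U ->
  exists e, [/\ e \in E, v \in ends e & inr (e, v) \notin Z].
Proof.
rewrite in_U => /andP[vS]; rewrite inE in_setC vS /= negb_forall => /existsP[e].
by rewrite negb_imply => /andP[/andP[eE ve] hZ]; exists e.
Qed.

Lemma joined_copies c c' : tag c \in U -> tag c' = tag c ->
  inl c \notin Z -> inl c' \notin Z -> joined (inl c) (inl c').
Proof.
move=> cU cc' cZ c'Z; have [e [eE ve hZ]] := U_half cU.
have hA := half_in eE ve hZ.
apply: (@connect_trans _ _ (inr (e, tag c))); apply: joined1 => //=.
- exact: copy_in.
- exact: copy_in.
by rewrite cc'.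
Qed.

(** An edge of [K] lifts to a path copy, half, half, copy outside the barrier: both halves survive,
    and both ends lie in [U] and so keep a copy. *)
Lemma joined_tree u w c c' : connect (adj K set0) u w -> u \in U ->
  tag c = u -> tag c' = w -> inl c \notin Z -> inl c' \notin Z ->
  joined (inl c) (inl c').
Proof.
case/connectP => p; elim: p u c => [|t p IHp] u c /=.
  by move=> _ -> uU cu c'u cZ c'Z; apply: joined_copies => //; rewrite cu.
rewrite adj_ends => /andP[/exists_inP[e eK /eqP Ee] pth] lw uU cu c'w cZ c'Z.
move: eK; rewrite inE => /and3P[eT0 eU /forall_inP eZ];
  have eE := subsetP T0E e eT0.
have ue : u \in ends e by rewrite Ee !inE eqxx.
have te : t \in ends e by rewrite Ee !inE eqxx orbT.
have ut : u != t.
  by apply/eqP => ut; have := ends_card e; rewrite Ee ut setUid cards1.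
have tU := subsetP eU t te; have [d dt dZ] := U_copy tU.
have hu := half_in eE ue (eZ u ue); have ht := half_in eE te (eZ t te).
apply: connect_trans (IHp t d pth lw tU dt c'w dZ c'Z).
apply: (@connect_trans _ _ (inr (e, u))).
  by apply: joined1 => //=; [exact: copy_in | rewrite cu].
apply: (@connect_trans _ _ (inr (e, t))).
  by apply: joined1 => //=; rewrite eqxx ut.
by apply: joined1 => //=; [exact: copy_in | rewrite dt].
Qed.

Definition owner (x : gadget) : G :=
  match x with
  | inl c => tag c
  | inr h => if h.2 \in U then h.2 else odflt h.2 [pick w in ends h.1 | w != h.2]
  end.

Lemma C_sub x : x \in C -> x \in A' /\ s x = x.
Proof. by rewrite inE => /andP[-> /eqP]. Qed.

(** A half at [S] that is not in [C2] still has its other half, through which it reaches a vertex of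
    [U]. *)
Lemma ownerP x : x \in C3 -> owner x \in U /\
  forall c, tag c = owner x -> inl c \notin Z -> joined x (inl c).
Proof.
rewrite in_setD in_setU negb_or => /andP[/andP[xC1 xC2] xC].
have [xA sx] := C_sub xC; case: x => [c|[e v]] in xC1 xC2 xC xA sx *.
  have cZ : inl c \notin Z by move: xA; rewrite in_setD => /andP[].
  have cU : tag c \in U.
    by rewrite in_U copy_S //; move: xC1; rewrite inE xC.
  by split=> //= c' c'c c'Z; apply: joined_copies.
have vT := half_T xA; have [eE ve hZ] := half_out xA.
rewrite /owner /=; have [vU|vU] := boolP (v \in U).
  split=> // c cv cZ; apply: joined1 => //; first exact: copy_in.
  by rewrite /= cv.
have vS : v \in S by move: vU; rewrite in_U vT andbT negbK.
case: pickP => [w /andP[we wv]|none] /=; last first.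
  have /subsetPn[w we] : ~~ (ends e \subset [set v]).
    by apply/negP => /subset_leq_card; rewrite ends_card cards1.
  by rewrite inE => wv; have := none w; rewrite we wv.
have wZ : inr (e, w) \notin Z.
  move: xC2; rewrite inE xC /= vS /=; apply: contra => wZ.
  by apply/exists_inP; exists w; rewrite // wv.
have wA := half_in eE we wZ; have wT := half_T wA.
have adjw : joined (inr (e, v)) (inr (e, w)).
  by apply: joined1; rewrite //= eqxx eq_sym.
(* For [w] in [S] all copies are deleted, so its half could only be matched to the half at [v],
   which is unmatched. Both halves would then be unmatched and adjacent, against separation. *)
have wS : w \notin S.
  apply/negP => wS.
  have [sw|sw] := eqVneq (s (inr (e, w))) (inr (e, w)).
    have wC : inr (e, w) \in C by rewrite inE wA sw eqxx.
    have vw : inr (e, v) != inr (e, w) :> gadget.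
      by apply/eqP => -[vw]; rewrite vw eqxx in wv.
    by have := s_separated xC wC vw; rewrite -/joined adjw.
  have [sK sA] := matchingP _ _ _ s_matching.
  have [_ +] := sA _ sw; have ssw : s (s (inr (e, w))) != s (inr (e, w)).
    by rewrite sK eq_sym.
  have [+ _] := sA _ ssw; case E1: (s (inr (e, w))) => [c|[e' u]] => inA /=.
    move=> /eqP cw; have cZ : inl c \notin Z by move: inA;
      rewrite in_setD => /andP[].
    by have := copy_S cZ; rewrite cw wS.
  move=> /andP[/eqP ee' wu]; subst e'; have [_ ue _] := half_out inA.
  have uv : u = v.
    move: ue; rewrite (ends_eq we ve wv) !inE => /orP[/eqP uw|/eqP//].
    by rewrite uw eqxx in wu.
  by case/eqP: wv; rewrite -uv; move: sx; rewrite -uv -{1}E1 sK => -[].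
have wU : w \in U by rewrite in_U wS.
split=> // c cw cZ; apply: connect_trans adjw _.
by apply: joined1 => //=; [exact: copy_in | rewrite cw].
Qed.

Lemma C3_eq x y : x \in C3 -> y \in C3 ->
  connect (adj K set0) (owner x) (owner y) -> x = y.
Proof.
move=> x3 y3 Kxy; apply/eqP/contraT => xy.
have [xU xc] := ownerP x3; have [yU yc] := ownerP y3.
have [c cx cZ] := U_copy xU; have [c' cy c'Z] := U_copy yU.
have xC : x \in C by move: x3; rewrite in_setD => /andP[].
have yC : y \in C by move: y3; rewrite in_setD => /andP[].
have := s_separated xC yC xy; rewrite -/(joined x y) => /negP[].
apply: connect_trans (xc c cx cZ) _.
apply: connect_trans (joined_tree Kxy xU cx cy cZ c'Z) _.
by rewrite -/(joined _ _) joined_sym; apply: yc.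
Qed.

Lemma card_C3 : #|C3| + #|K| <= #|U|.
Proof.
have inj : {in C3 &, injective owner}.
  by move=> x y x3 y3 E1; apply: C3_eq => //; rewrite E1.
rewrite -(card_in_imset inj); apply: forest_separated.
- by apply: sparseS T0_sparse; apply/subsetP => e; rewrite inE => /andP[].
- by move=> e; rewrite inE => /and3P[].
- by apply/subsetP => _ /imsetP[x /ownerP[xU _] ->].
move=> _ _ /imsetP[x x3 ->] /imsetP[y y3 ->]; apply: contra => Kxy.
by rewrite (C3_eq x3 y3 Kxy).
Qed.

Lemma card_C1 : #|C1| <= \sum_(v in T) f v.
Proof.
rewrite -card_copies; apply: (@leq_card_rel _ _ _ _ (fun x c => x == inl c)).
  by move=> [c|h]; rewrite inE => /andP[_] // cT; exists c; rewrite // inE.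
by move=> x y c _ _ _ /eqP-> /eqP->.
Qed.

Lemma card_C2 : #|C2| <= #|Y|.
Proof.
apply: (@leq_card_rel _ _ _ _ (fun x h => if x is inr g then
  [&& g.1 == h.1, g.2 != h.2, g.2 \in ends g.1 & h.2 \in ends h.1] else false)).
  move=> [c|[e v]];
    rewrite inE => /andP[// xC /= /andP[vS /exists_inP[w we /andP[wv wZ]]]].
  have [xA _] := C_sub xC; have [_ ve _] := half_out xA.
  exists (e, w); last by rewrite /= eqxx eq_sym wv ve.
  by rewrite inE wZ; apply/exists_inP; exists v; rewrite // eq_sym wv.
move=> [c|[e v]] [c'|[e' v']] [g w] _ _ _ //= /and4P[/eqP-> vw ve we].
move=> /and4P[/eqP ee' v'w v'e _]; subst e'; congr (inr (_, _)).
by apply/eqP; move: v'e; rewrite (ends_eq ve we vw) !inE (negbTE v'w) orbF eq_sym.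
Qed.

(** An edge of [T0] outside [K] either has an end in [S] or [T], or lies inside [U] and has a
    deleted half. *)
Lemma card_T0 : #|T0| <= #|K| + \sum_(v in S :|: T) degree T0 v +
  #|[set h : edge G * G | (inr h \in Z) && (ends h.1 \subset U)]|.
Proof.
set ZU := [set h | _].
pose B := [set e in T0 | ~~ (ends e \subset U)].
pose D := [set e in T0 | (ends e \subset U) && [exists v in ends e, inr (e,
  v) \in Z]].
have cB : #|B| <= \sum_(v in S :|: T) degree T0 v.
  rewrite sum_degree card_sum_mem [X in _ <= X]big_mkcond; apply: leq_sum => e _.
  rewrite inE; case: (e \in T0) => //=.
  have [//|/subsetPn[v ve]] := boolP (ends e \subset U).
  by rewrite in_setC negbK => vST; rewrite card_gt0; apply/set0Pn; exists v;
    rewrite inE ve.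
have cD : #|D| <= #|ZU|.
  apply: (@leq_card_rel _ _ _ _ (fun e h => e == h.1)); last first.
    by move=> e e' h _ _ _ /eqP-> /eqP->.
  move=> e; rewrite inE => /and3P[_ eU /exists_inP[v _ hZ]].
  by exists (e, v); rewrite // inE hZ.
suff : #|T0| <= #|K| + #|B| + #|D| by arith.
apply: leq_trans (_ : #|K :|: B :|: D| <= _); last first.
  by rewrite !cardsU; arith.
apply/subset_leq_card/subsetP => e eT0; rewrite !in_setU !inE eT0 /=.
case: (ends e \subset U) => //=; rewrite orbF.
by rewrite -negb_exists_in orNb.
Qed.

(** The four terms count disjoint parts of [Z]: copies at [S], halves at [T] of edges avoiding [S],
    halves opposite to [S], and halves of edges inside [U]. *)
Lemma card_barrier :
  \sum_(v in S) f v + \sum_(v in T) degree (avoiding E S) v + #|Y| +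
  #|[set h : edge G * G | (inr h \in Z) && (ends h.1 \subset U)]| <= #|Z|.
Proof.
set ZU := [set h | _].
rewrite card_gadget_set -!addnA; apply: leq_add.
  rewrite -card_copies; apply/subset_leq_card/subsetP => c; rewrite !inE.
  by move=> /forallP/(_ c); rewrite eqxx.
pose W := [set h :
  edge G * G | [&& h.2 \in T, h.1 \in avoiding E S & h.2 \in ends h.1]].
have <- : #|W| = \sum_(v in T) degree (avoiding E S) v by exact: card_halves.
have WY : W :&: Y = set0.
  apply/eqP; rewrite -subset0; apply/subsetP => -[e v].
  rewrite in_setI [_ \in W]inE [_ \in Y]inE /=.
  case/andP=> /and3P[_ + _] /andP[_ /exists_inP[w we /andP[_ wS]]].
  rewrite inE => /andP[_]; rewrite disjoint_subset => /subsetP/(_ w we).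
  by rewrite inE wS.
have WU : (W :|: Y) :&: ZU = set0.
  apply/eqP; rewrite -subset0; apply/subsetP => -[e v].
  rewrite in_setI in_setU [_ \in W]inE [_ \in Y]inE [_ \in ZU]inE /=.
  case/andP=> /orP[/and3P[vT _ ve]|/andP[_ /exists_inP[w we /andP[_ wS]]]].
    by move=> /andP[_ /subsetP/(_ v ve)]; rewrite in_U vT andbF.
  by move=> /andP[_ /subsetP/(_ w we)]; rewrite in_U wS.
have := cardsUI W Y; rewrite WY cards0; have := cardsUI (W :|: Y) ZU;
  rewrite WU cards0.
suff : #|W :|: Y :|: ZU| <= #|[set h | inr h \in Z]| by arith.
apply/subset_leq_card/subsetP => -[e v]; rewrite !in_setU => /orP[/orP[]|].
- rewrite [_ \in W]inE [_ \in [set _ | _]]inE /= => /and3P[vT + ve].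
  rewrite inE => /andP[eE _].
  by move: vT; rewrite inE => /andP[_ /forallP/(_ e)]; rewrite eE ve.
- by rewrite ![_ \in [set _ | _]]inE => /andP[].
by rewrite ![_ \in [set _ | _]]inE => /andP[].
Qed.

(** The final 1 comes from the tree having |V| - 1 edges: |U| - |K| is at most 1 - |S| - |T| plus
    the edges of [T0] lost from [K]. *)
Lemma card_unmatched_barrier :
  \sum_(v in T) f v + \sum_(v in S :|: T) degree T0 v <=
    \sum_(v in S) f v + \sum_(v in T) degree (avoiding E S) v + #|S| + #|T| ->
  #|C| <= #|Z| + 1.
Proof.
move=> crit; have := card_barrier; have := card_T0; have := card_C1;
  have := card_C2.
have := card_C3; have := cardsUI S T; rewrite disjoint_ST cards0.
have := cardsC (S :|: T); rewrite -cardsT -/U.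
have : #|C| <= #|C1| + #|C2| + #|C3|.
  have := cardsID (C1 :|: C2) C; rewrite -/C3.
  have := subset_leq_card (subsetIr C (C1 :|: C2)); rewrite cardsU; arith.
move: T0_card crit; arith.
Qed.

End Barrier.

Theorem tree_factor (T0 : factor G) :
  sparse 1 T0 -> #|T0| + 1 = #|[set: G]| -> T0 \subset E -> ~~ odd (\sum_v f v) ->
  (forall S T, S :&: T = set0 ->
    \sum_(v in T) f v + \sum_(v in S :|: T) degree T0 v <=
      \sum_(v in S) f v + \sum_(v in T) degree (avoiding E S) v + #|S| + #|T|) ->
  exists J : factor G, J \subset E /\ forall v, degree J v = f v.
Proof.
move=> sT0 cT0 T0E f_even crit.
have [s mxs] := exists_maximum_matching gadget_adj gadget_vertices.
have [ms smin] := maximum_matchingP _ _ _ mxs.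
have [un0|un0] := eqVneq (unmatched gadget_vertices s) set0.
  exact: factor_of_matching ms un0.
(* Parity turns one unmatched vertex into two, just enough to beat the slack of 1 in
   [card_unmatched_barrier]. *)
have un2 : 2 <= #|unmatched gadget_vertices s|.
  have := odd_unmatched ms; rewrite odd_gadget (negbTE f_even).
  by move: un0; rewrite -card_gt0; case: #|_| => [|[]].
have dmin s' : matching gadget_adj gadget_vertices s' ->
  2 <= #|unmatched gadget_vertices s'|.
  by move/smin; apply: leq_trans.
have [Z [s' [ZA ms' cZ sep]]] := tutte_berge gadget_adj_sym dmin.
have := card_unmatched_barrier sT0 cT0 T0E ms' sep (crit _ _ (disjoint_ST _)).
by move: cZ; arith.
Qed.

End Gadget.

(** * The degree condition in a tough graph *)

Section Criterion.

Variable G : multigraph.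
Implicit Types (F : factor G) (S T I : {set G}) (e : edge G) (u v : G).

Lemma degreeU F F' v : [disjoint F & F'] ->
  degree (F :|: F') v = degree F v + degree F' v.
Proof.
rewrite -setI_eq0 => /eqP FF'.
have E : [set e in F :|: F' | v \in ends e] =
         [set e in F | v \in ends e] :|: [set e in F' | v \in ends e].
  by apply/setP => e; rewrite !inE andb_orl.
rewrite /degree E cardsU (_ : _ :&: _ = set0) ?cards0 ?subn0 //.
apply/eqP; rewrite -subset0 -FF'; apply/subsetP => e.
by rewrite !inE => /andP[/andP[-> _] /andP[-> _]].
Qed.

Lemma card_leaving S I : #|leaving S I| <= \sum_(v in I) degree (avoiding setT S) v.
Proof.
rewrite sum_degree card_sum_mem [X in _ <= X]big_mkcond; apply: leq_sum => e _.
rewrite !inE /=; case: [disjoint ends e & S] => //=.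
case: (boolP [disjoint ends e & I]) => //= /meetP[x xe xI].
case: (~~ _) => //; rewrite card_gt0; apply/set0Pn; exists x; by rewrite inE xe.
Qed.

Lemma card_neighbors S (Q : {set G}) v : v \notin S -> [disjoint Q & S] ->
  #|[set u in Q | (u != v) && [exists e, ends e == [set v; u]]]| <=
    degree (avoiding setT S) v.
Proof.
move=> vS QS; apply: (@leq_card_rel _ _ _ _ (fun u e => ends e == [set v; u])).
  move=> u; rewrite inE => /and3P[uQ uv /existsP[e /eqP Ee]].
  exists e; last by rewrite Ee.
  rewrite !inE Ee !inE eqxx /= andbT.
  rewrite -setI_eq0 -subset0; apply/subsetP => w; rewrite !inE.
  case/andP=> /orP[]/eqP-> wS; first by rewrite wS in vS.
  by move: QS; rewrite disjoint_subset => /subsetP/(_ u uQ); rewrite inE wS.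
move=> u u' e; rewrite !inE => /and3P[_ uv _] /and3P[_ u'v _] _ /eqP-> /eqP E.
have : u \in [set v; u'] by rewrite -E !inE eqxx orbT.
by rewrite !inE (negbTE uv) => /eqP.
Qed.

Lemma nat_tough_isolated b S I : nat_tough G (4 * b ^ 2) ->
  4 * b ^ 2 <= #|[set: G]| ->
  I != set0 -> [disjoint I & S] ->
  {in I &, forall u v, u != v -> ~~ [exists e, ends e == [set u; v]]} ->
  (forall v, v \in I -> degree (avoiding setT S) v < 3 * b) ->
  4 * b ^ 2 * #|I| <= #|S| + 3 * b * #|I|.
Proof.
move=> tG n_ge I0 IS indep deg.
(* The additional |I| comes from the strict degree bound; it pays for the vertex itself when
   [nat_tough_cut1] exhausts the graph. *)
have lv : #|leaving S I| + #|I| <= 3 * b * #|I|.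
  apply: leq_trans (_ : \sum_(v in I) degree (avoiding setT S) v + #|I| <= _).
    by rewrite leq_add2r card_leaving.
  have -> : 3 * b * #|I| = \sum_(v in I) 3 * b by rewrite sum_nat_const mulnC.
  rewrite -sum1_card -big_split /=; apply: leq_sum => v /deg.
  by rewrite addn1.
have [I1|I2] := leqP #|I| 1.
  have cI : #|I| = 1 by apply/eqP; rewrite eqn_leq I1 card_gt0.
  by move: lv; case: (nat_tough_cut1 tG I0 IS); rewrite cI; arith.
pose J := [set [set v] | v in I].
have cJ : #|J| = #|I| by apply/card_imset/set1_inj.
have cov : cover J = I.
  apply/setP => v; apply/bigcupP/idP => [[_ /imsetP[u uI ->]]|vI].
    by rewrite inE => /eqP->.
  by exists [set v]; rewrite ?set11 // imset_f.
have := @nat_tough_cut G _ S J tG; rewrite cov cJ.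
have -> : trivIset J.
  apply/trivIsetP => _ _ /imsetP[u _ ->] /imsetP[v _ ->] uv.
  by rewrite disjoints1 inE; apply: contra uv => /eqP->.
have -> : set0 \notin J.
  by apply/imsetP => -[u _ /esym/eqP]; rewrite -cards_eq0 cards1.
have sep e P Q : P \in J -> Q \in J -> ~~ [disjoint ends e & P] ->
    ~~ [disjoint ends e & Q] -> P = Q.
  move=> /imsetP[u uI ->] /imsetP[v vI ->] /meetP[x xe] + /meetP[y ye].
  rewrite !inE => /eqP xu /eqP yv; rewrite {}xu {}yv in xe ye.
  have [->//|uv] := eqVneq u v; case/negP: (indep u v uI vI uv).
  by apply/existsP; exists e; rewrite (ends_eq xe ye uv).
move=> /(_ isT isT IS sep I2); move: lv; arith.
Qed.

Lemma avoiding_degree_le (E : factor G) S v :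
  degree (avoiding setT S) v <= degree (avoiding E S) v + degree (~: E) v.
Proof.
apply: leq_trans (leq_card_setU _ _); apply/subset_leq_card/subsetP => e.
by rewrite !inE; case: (e \in E); case: [disjoint _ & _]; case: (v \in _).
Qed.

(** A vertex of [S] contributes at least 4: 3 from [f v] over [degree T0 v], and 1 from |S|. A
    vertex of [T] is paid for by 2 b edges avoiding [S]; those with fewer form [T'] and cost at most
    2 b each. *)
Lemma nat_tough_criterion b (E T0 : factor G) (f : G -> nat) S T :
  nat_tough G (4 * b ^ 2) -> 4 * b ^ 2 <= #|[set: G]| -> 1 < b ->
  (forall v, degree (~: E) v <= b) ->
  (forall v, degree T0 v + 3 <= f v) ->
  (forall v, f v + degree T0 v <= 2 * b) ->
  S :&: T = set0 ->
  \sum_(v in T) f v + \sum_(v in S :|: T) degree T0 v <=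
    \sum_(v in S) f v + \sum_(v in T) degree (avoiding E S) v + #|S| + #|T|.
Proof.
move=> tG n_ge b1 dE f_ge f_le ST.
pose T' := [set v in T | degree (avoiding E S) v < 2 * b].
have T'T : T' \subset T by apply/subsetP => v; rewrite inE => /andP[].
have cST : \sum_(v in S :|: T) degree T0 v =
    \sum_(v in S) degree T0 v + \sum_(v in T) degree T0 v.
  rewrite -bigU //=; last by rewrite -setI_eq0 ST.
  by apply: eq_bigl => v; rewrite inE.
have cS : \sum_(v in S) degree T0 v + 3 * #|S| <= \sum_(v in S) f v.
  by rewrite mulnC -sum_nat_const -big_split leq_sum.
have cT : \sum_(v in T) f v + \sum_(v in T) degree T0 v <=
    \sum_(v in T) degree (avoiding E S) v + #|T| + 2 * b * #|T'|.
  have -> : 2 * b * #|T'| = \sum_(v in T) (v \in T') * (2 * b).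
    rewrite mulnC -sum_nat_const big_mkcond [RHS]big_mkcond.
    apply: eq_bigr => v _; case: (boolP (v \in T')) => vT'.
      by rewrite (subsetP T'T) // mul1n.
    by rewrite mul0n if_same.
  rewrite -sum1_card -!big_split; apply: leq_sum => v vT /=.
  by rewrite inE vT; have := f_le v; case: ltnP; arith.
suff : b * #|T'| <= 2 * #|S|.
  by rewrite cST; move: cS cT; rewrite -mulnA; arith.
have T'S (Q : {set G}) : Q \subset T' -> [disjoint Q & S].
  move=> QT'; rewrite -setI_eq0 -subset0 -ST setIC setIS //.
  exact: subset_trans QT' T'T.
(* Of the 3 b, 2 b comes from the definition of [T'] and b from the edges outside [E]. *)
have deg v : v \in T' -> degree (avoiding setT S) v < 3 * b.
  rewrite inE => /andP[_ dv]; have := avoiding_degree_le E S v; have := dE v.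
  by move: dv; arith.
pose r : rel G := fun u v => [exists e, ends e == [set u; v]].
have r_sym : symmetric r by move=> u v; apply: eq_existsb => e; rewrite setUC.
have [T'0|T'0] := eqVneq T' set0; first by rewrite T'0 cards0 muln0.
have [I [IT' cI indep]] : exists I :
  {set G}, [/\ I \subset T', #|T'| <= 3 * b * #|I|
     & {in I &, forall x y, x != y -> ~~ r x y}].
  apply: exists_independent_set r_sym _ => Q QT' /set0Pn[v vQ]; exists v => //.
  have vT' := subsetP QT' v vQ; apply: leq_ltn_trans (deg v vT').
  apply: card_neighbors (T'S _ QT').
  by have := T'S _ QT'; rewrite disjoint_subset => /subsetP/(_ v vQ); rewrite inE.
have I0 : I != set0.
  by apply: contraNneq T'0 => IE; rewrite -cards_eq0; move: cI;
    rewrite IE cards0 muln0 leqn0.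
have := nat_tough_isolated tG n_ge I0 (T'S _ IT') indep.
move=> /(_ (fun v vI => deg v (subsetP IT' v vI))).
(* From |T'| <= 3 b |I| and (4 b^2 - 3 b) |I| <= |S| the claim reduces to 3 b^2 <= 8 b^2 - 6 b,
   which holds for b >= 2. *)
move: cI b1; move: #|I| #|S| #|T'| => i s t; clear; nia.
Qed.

End Criterion.

(** * Assembling the tree packings and the factor *)

Theorem theorem5p3 (R : realType) (G : multigraph) (k b m m0 : nat)
  (f : G -> nat)
  (f_pos : forall v, 0 < f v)
  (f_bounds : forall v, 3 * m + 2 * m0 + 6 * k < f v + k <= b)
  (m_m0_k : m + m0 < k)
  (G_tough : tough ((4 * b ^ 2)%:R : R)%R G)
  (G_large : 4 * b ^ 2 <= #|G|)
  (f_even : ~~ odd ((k - 1) * \sum_(v : G) f v)) :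
  exists H : factor G,
    [/\ tree_connected m H,
        tree_connected m0 (~: H)
      & forall v, degree H v = f v \/ degree H v = f v + k].
Proof.
have tG := tough_nat_tough G_tough.
have b0 : 0 < b.
  by case: G_tough => + _; rewrite Num.Theory.ltr0n; case: (b) => //; rewrite muln0.
have n_ge : 4 * b ^ 2 <= #|[set: G]| by rewrite cardsT.
have n0 : 0 < #|[set: G]| by apply: leq_trans n_ge; rewrite muln_gt0 expn_gt0 b0.
have [v0 _] := card_gt0P n0.
pose M := (m + m0).+1.
(* As k >= M, b exceeds 6 k + 2 (m + m0) >= 8 M - 2. *)
have bM : 7 * M <= b.
  by have /andP[] := f_bounds v0; rewrite /M; move: m_m0_k; arith.
have t_gt : 4 * M ^ 2 < 4 * b ^ 2.
  by move: bM; rewrite /M; move: (m + m0) => j; clear; nia.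
have n_gt : 8 * M ^ 2 < #|[set: G]|.
  apply: leq_trans n_ge; by move: bM; rewrite /M; move: (m + m0) => j; clear; nia.
have [F [sF cF dF]] := tough_bounded_sparse (ltn0Sn _) tG t_gt n_gt.
have [T [TF Tt Td]] := nash_williams n0 sF cF.
have Tst i : i < M -> spanning_tree (T i).
  by move=> /Tt[sT cT]; split; [exact: sparse1_connected | exact: sparse1_acyclic].
have Tdisj i j : i < M -> j < M -> i != j -> [disjoint T i & T j].
  move=> iM jM; rewrite neq_ltn => /orP[ij|ji]; first by apply: Td; rewrite ij.
  by rewrite disjoint_sym; apply: Td; rewrite ji.
pose U1 := \bigcup_(i < m) T i; pose U2 := \bigcup_(i < m0) T (m + i).
pose T3 := T (m + m0).
have dis (A B : factor G) : (forall e, e \in A -> e \notin B) -> [disjoint A & B].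
  by move=> AB; rewrite disjoint_subset; apply/subsetP => e /AB; rewrite inE.
have disT e i j : i < M -> j < M -> i != j -> e \in T i -> e \notin T j.
  move=> iM jM ij eT; have := Tdisj i j iM jM ij.
  by rewrite disjoint_subset => /subsetP/(_ e eT); rewrite inE.
have U12 : [disjoint U1 & U2].
  apply: dis => e /bigcupP[i _ eT]; apply/bigcupP => -[j _]; apply/negP.
  by apply: disT eT; rewrite /M; have := ltn_ord i; have := ltn_ord j; arith.
have U13 : [disjoint U1 & T3].
  apply: dis => e /bigcupP[i _ eT].
  by apply: disT eT; rewrite /M; have := ltn_ord i; arith.
have U23 : [disjoint T3 & U1 :|: U2].
  apply: dis => e eT; rewrite inE; apply/norP; split; apply/bigcupP => -[j _];
    apply/negP;
    by apply: disT eT; rewrite /M; have := ltn_ord j; arith.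
have U1F : U1 \subset F.
  by apply/bigcupsP => i _; apply: TF; rewrite /M; have := ltn_ord i; arith.
have U2F : U2 \subset F.
  by apply/bigcupsP => i _; apply: TF; rewrite /M; have := ltn_ord i; arith.
have T3F : T3 \subset F by apply: TF.
have [sT3 cT3] : sparse 1 T3 /\ #|T3| + 1 = #|[set: G]| by exact: Tt.
have d13 v : degree U1 v + degree T3 v <= 2 * M + 1.
  by rewrite -degreeU //; apply: leq_trans (dF v); apply/degreeS;
    rewrite subUset U1F.
pose E := ~: (U1 :|: U2).
have dE v : degree (~: E) v <= b.
  rewrite setCK; apply: leq_trans (_ : 2 * M + 1 <= b); last by move: bM;
    rewrite /M; arith.
  by apply: leq_trans (dF v); apply/degreeS; rewrite subUset U1F.
(* If the sum of [f] is odd, the parity hypothesis makes k - 1 even, so adding the odd number k at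
   [v0] corrects the parity. *)
have [g [g_even gf]] : exists g : G -> nat, ~~ odd (\sum_v g v) /\
    forall v, g v = f v \/ g v = f v + k.
  have [f_odd|] := boolP (odd (\sum_v f v)); last by exists f; split=> // v; left.
  exists (fun v => f v + (v == v0) * k); split.
    have sk : \sum_v (v == v0) * k = k.
      by rewrite (bigD1 v0) //= eqxx mul1n big1 ?addn0 // => v /negbTE->.
    rewrite big_split /= sk oddD f_odd.
    by move: f_even m_m0_k; rewrite oddM f_odd andbT; arith.
  by move=> v; case: (v == v0); [right; rewrite mul1n | left; rewrite addn0].
(* [U1] and [T3] use at most 2 M + 1 edges at a vertex; the remaining 3 are those demanded by
   [nat_tough_criterion]. *)
have g_bounds v : 2 * M + 4 <= g v <= b.
  by have /andP[] := f_bounds v; case: (gf v) => ->; rewrite /M; move: m_m0_k;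
    arith.
pose h v := g v - degree U1 v.
have hg v : h v + degree U1 v = g v.
  by rewrite /h; have := d13 v; have /andP[] := g_bounds v; arith.
have h_even : ~~ odd (\sum_v h v).
  suff : \sum_v h v + 2 * #|U1| = \sum_v g v by move: g_even; arith.
  by rewrite -sum_degreeT -big_split; apply: eq_bigr => v _; apply: hg.
have [J [JE dJ]] : exists J : factor G, J \subset E /\ forall v, degree J v = h v.
  apply: (tree_factor sT3 cT3) => //; first by rewrite -disjoints_subset.
  move=> S X; apply: (nat_tough_criterion tG) => // [|v|v].
  - by move: bM; rewrite /M; arith.
  - by have := d13 v; have := hg v; have /andP[] := g_bounds v; arith.
  by have := d13 v; have := hg v; have /andP[] := g_bounds v; move: bM; rewrite /M;
    arith.
have JU : J \subset ~: (U1 :|: U2) by [].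
exists (U1 :|: J); split.
- exists (fun i : 'I_m => T i); split=> [i|i|i j ij].
  + by apply: subset_trans (subsetUl _ _); apply: (bigcup_sup i).
  + by apply: Tst; rewrite /M; have := ltn_ord i; arith.
  by apply: Tdisj => //; rewrite /M; [have := ltn_ord i | have := ltn_ord j]; arith.
- exists (fun i : 'I_m0 => T (m + i)); split=> [i|i|i j ij].
  + rewrite -disjoints_subset; apply: dis => e eT.
    have eU2 : e \in U2 by apply/bigcupP; exists i.
    rewrite inE; apply/norP; split.
      by apply/negP => eU1; move: U12;
        rewrite disjoint_subset => /subsetP/(_ e eU1); rewrite inE eU2.
    by apply/negP => /(subsetP JU); rewrite !inE eU2 orbT.
  + by apply: Tst; rewrite /M; have := ltn_ord i; arith.
  apply: Tdisj; rewrite ?eqn_add2l // /M; [have := ltn_ord i | have := ltn_ord j];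
    arith.
move=> v; rewrite degreeU; first by rewrite dJ addnC hg; apply: gf.
apply: dis => e eU1; apply/negP => /(subsetP JU); by rewrite !inE eU1.
Qed.
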